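(* Let $X$ be a locally convex space and $p_1>1$. Suppose that a net of Radon probability measures $\mu_\alpha$ on $X$, each of which is stable of some order $p_\alpha>p_1$ (the orders may depend on $\alpha$), converges weakly to a Radon measure $\mu$. Then $\mu_\alpha\to\mu$ in the Kantorovich topology $\tau_K$. Hence the barycenters of $\mu_\alpha$ converge to the barycenter of $\mu$.
   Context: Locally convex spaces are real and Hausdorff. A finite nonnegative Borel measure $\mu$ is Radon if for every Borel set $B$ and $\varepsilon>0$ there is a compact $K\subset B$ with $\mu(B\setminus K)<\varepsilon$; a signed Borel measure is Radon if its total variation $|\mu|$ is. A Radon probability measure $\mu$ on $X$ is stable of order $p\in(0,2]$ if for all $a>0$ and $b>0$ there is a vector $v\in X$ such that the image of $\mu$ under the mapping $x\mapsto(a^p+b^p)^{1/p}x+v$ equals the convolution of the images of $\mu$ under the homotheties $x\mapsto ax$ and $x\mapsto bx$; that is, if $\xi,\eta$ are independent random vectors with distribution $\mu$, then $a\xi+b\eta$ has the same law as $(a^p+b^p)^{1/p}\xi+v$. It is known that for stable measures of order $p>1$ all measurable seminorms are integrable and a barycenter exists, and that a weak limit $\mu$ as in the claim is itself stable of some order at least $p_1$. Weak convergence means convergence of the integrals of every bounded continuous function. A measure $\mu$ has a barycenter $m_\mu\in X$ if $X^*\subset L^1(|\mu|)$ and $f(m_\mu)=\int_X f\,d\mu$ for every $f\in X^*$. The topology $\tau_K$ on the space $\mathcal{M}_r^1(X)$ of (signed) Radon measures $\mu$ for which all continuous seminorms are $|\mu|$-integrable is generated by the seminorms $$\|\mu\|_{K,p}=\sup\Bigl\{\int_X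 f\,d\mu\colon |f(x)-f(y)|\le p(x-y)\ \forall x,y\in X,\ f(x_0)=0\Bigr\}+|\mu(X)|,$$ where $p$ ranges over all continuous seminorms on $X$ and $x_0\in X$ is a fixed point (e.g. $x_0=0$). *)

(* Defs.v *)
From HB Require Import structures.
From mathcomp Require Import all_boot all_order all_algebra.
From mathcomp Require Import all_classical all_reals all_analysis.

Set Implicit Arguments.
Unset Strict Implicit.
Unset Printing Implicit Defensive.

Import Order.TTheory GRing.Theory Num.Theory.
Import numFieldNormedType.Exports.

Local Open Scope classical_set_scope.
Local Open Scope ring_scope.

(* [tvsType R] is the library's type of locally convex spaces over [R]; it does
   not include separation, so [hausdorff_space X] is a separate hypothesis. *)

(* Measurable types of the library are pointed. *)
HB.instance Definition _ (R : realType) (X : tvsType R) :=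
  isPointed.Build X 0.

Notation borel X := (g_sigma_algebraType (@open X)).

Definition directed (I : Type) (le : I -> I -> Prop) : Prop :=
  [/\ inhabited I,
      forall i, le i i,
      forall i j k, le i j -> le j k -> le i k &
      forall i j, exists2 k, le i k & le j k].

Definition net_filter (I : Type) (le : I -> I -> Prop) : set_system I :=
  filter_from setT (fun i0 => [set i | le i0 i]).

Section SignedMeasures.
Context (R : realType) (d : measure_display) (T : measurableType d).
Implicit Type nu : {charge set T -> \bar R}.

Definition hahn_pos nu : set T := projT1 (cid (Hahn_decomposition nu)).

Definition hahn_neg nu : set T :=
  projT1 (cid (projT2 (cid (Hahn_decomposition nu)))).

Lemma hahn_posnegP nu : hahn_decomposition nu (hahn_pos nu) (hahn_neg nu).
Proof. exact: projT2 (cid (projT2 (cid (Hahn_decomposition nu)))). Qed.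

(* The total variation measure |nu|. *)
Definition abs_charge nu : set T -> \bar R :=
  charge_variation (hahn_posnegP nu).

(* Meaningful when [f] is integrable with respect to [abs_charge nu]. *)
Definition cintegral nu (f : T -> R) : R :=
  Rintegral (jordan_pos (hahn_posnegP nu)) setT f -
  Rintegral (jordan_neg (hahn_posnegP nu)) setT f.

End SignedMeasures.

Section RadonMeasures.
Context (R : realType) (X : tvsType R).
Implicit Types (nu : {charge set (borel X) -> \bar R}) (p : X -> R).

(* For a finite nonnegative [m]; a signed measure [nu] is Radon when
   [radon (abs_charge nu)]. *)
Definition radon (m : set (borel X) -> \bar R) : Prop :=
  forall (B : set (borel X)) (e : R), measurable B -> 0 < e ->
    exists K : set X,
      [/\ compact K, K `<=` B & (m (B `\` K : set (borel X)) < e%:E)%E].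

(* The image of the product of [m1] and [m2] under addition. Addition need not
   be measurable for the product of the two Borel sigma-algebras when [X] is not
   separable; for Radon [m1] the integrand [y |-> m1 (B - y)] is nonetheless
   Borel, and the formula agrees with the image of the Radon extension of the
   product measure. *)
Definition convolution (m1 m2 : set (borel X) -> \bar R) (B : set (borel X)) :
    \bar R :=
  (\int[m2]_y m1 ([set x : X | B (x + (y : X))%R] : set (borel X)))%E.

Definition affine_image (m : set (borel X) -> \bar R) (c : R) (v : X) :
    set (borel X) -> \bar R :=
  pushforward m (fun x : borel X => (c *: (x : X) + v) : borel X).

Definition stable (p : R) (m : set (borel X) -> \bar R) : Prop :=
  0 < p <= 2 /\
  forall a b : R, 0 < a -> 0 < b -> exists v : X,
    forall B : set (borel X), measurable B ->
      affine_image m ((a `^ p + b `^ p) `^ p^-1) v B =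
      convolution (affine_image m a 0) (affine_image m b 0) B.

Definition weakly_converges (I : Type) (F : set_system I)
    (mu : I -> {charge set (borel X) -> \bar R}) nu : Prop :=
  forall f : X -> R, continuous f -> (exists M : R, forall x, `|f x| <= M) ->
    (fun i => cintegral (mu i) f) @ F --> cintegral nu f.

Definition seminorm p : Prop :=
  (forall x y, p (x + y) <= p x + p y) /\
  (forall (a : R) x, p (a *: x) = `|a| * p x).

Definition barycenter nu (b : X) : Prop :=
  forall f : {linear X -> R^o}, continuous f ->
    (abs_charge nu).-integrable setT (EFin \o (f : borel X -> R)) /\
    f b = cintegral nu (f : borel X -> R).

(* Membership in the space of signed Radon measures for which all continuous
   seminorms are integrable. *)
Definition radon1 nu : Prop :=
  radon (abs_charge nu) /\
  forall p, seminorm p -> continuous p ->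
    (abs_charge nu).-integrable setT (EFin \o (p : borel X -> R)).

Definition kantorovich_norm (x0 : X) p nu : R :=
  sup [set s | exists f : X -> R,
         [/\ forall x y, `|f x - f y| <= p (x - y), f x0 = 0 &
             s = cintegral nu (f : borel X -> R)]]
  + `|fine (nu setT)|.

(* The base point [x0] is a parameter of the type because the topology on it,
   generated by the balls of the seminorms [kantorovich_norm x0 p], depends on
   it. *)
Record kantorovich_space (x0 : X) := KantorovichSpace {
  kmeasure : {charge set (borel X) -> \bar R};
  kmeasureP : radon1 kmeasure }.

Definition kantorovich_ball (x0 : X) p (mu0 : kantorovich_space x0) (e : R) :
    set (kantorovich_space x0) :=
  [set nu | kantorovich_norm x0 p
              (cadd (kmeasure nu) (copp (kmeasure mu0))) < e].

Definition kantorovich_subbase (x0 : X) : set (set (kantorovich_space x0)) :=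
  [set U | exists p (mu0 : kantorovich_space x0) (e : R),
     [/\ seminorm p, continuous p, 0 < e & U = kantorovich_ball p mu0 e]].

End RadonMeasures.

HB.instance Definition _ (R : realType) (X : tvsType R) (x0 : X) :=
  gen_eqMixin (kantorovich_space x0).
HB.instance Definition _ (R : realType) (X : tvsType R) (x0 : X) :=
  gen_choiceMixin (kantorovich_space x0).
HB.instance Definition _ (R : realType) (X : tvsType R) (x0 : X) :=
  isSubBaseTopological.Build (kantorovich_space x0)
    (@kantorovich_subbase R X x0) id.

(* Main.v *)
Require Import Defs.
From HB Require Import structures.
From mathcomp Require Import all_boot all_order all_algebra.
From mathcomp Require Import all_classical all_reals all_analysis.
From mathcomp Require Import measurable_realfun.
From mathcomp Require Import ring lra.

Set Implicit Arguments.
Unset Strict Implicit.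
Unset Printing Implicit Defensive.

Import Order.TTheory GRing.Theory Num.Theory.
Import numFieldNormedType.Exports.

Local Open Scope classical_set_scope.
Local Open Scope ring_scope.

(** Adding two independent copies of a stable vector of order p > p1 > 1 scales
    it by c = 2^(1/p) <= 2^(1/p1) < 2, up to a translation v. For a continuous
    seminorm q the sum is large as soon as one copy is large and the other is
    not, which gives P(q > lam s) <= kap P(q > s) with lam * kap < 1, where lam
    and kap depend on p1 only: continuous seminorms are integrable, uniformly
    over all stable laws that are tight at one fixed level. Taking means gives
    f(v) = (2 - c) E f for f in X*, so v / (2 - c) is the barycenter; X need not
    be complete.

    A weakly convergent net is eventually tight at any level, so the seminorms
    are uniformly integrable along it. With a partition of unity on a compact
    set of almost full limit measure, weak convergence is then uniform over
    Lipschitz functions, which is convergence in the Kantorovich topology.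

    Tightness also confines the barycenters v / (2 - c) to arbitrarily small
    neighbourhoods of a fixed compact set, whence the limit has a barycenter in
    X itself. By the Hahn-Banach theorem a seminorm of a difference of
    barycenters is a difference of integrals of a linear Lipschitz function. *)

(** * Seminorms on a locally convex space *)

(** Up to small errors [lam] is c1 and [kap] is 1/2, because the two events in which exactly one
    copy is large together have nearly twice the probability of one large copy; the gap between c1
    and 2 pays for the errors. Three obstacles shape the rest. The limit is given as a signed
    measure seen only through continuous functions; it must first be shown nonnegative, by
    separating disjoint compact sets that carry almost all of its mass. Addition need not be
    measurable for the product of the Borel sigma-algebras, so convolutions are bounded below
    through simple functions, and means are computed only after a functional has mapped everything
    to the line. Finally, the net is tight only seminorm by seminorm: the laws eventually
    concentrate near a compact set, not on it. The barycenters are therefore close to a fixed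
    compact set for each seminorm separately, and the barycenter of the limit is found as a cluster
    point of approximate solutions inside that set. *)

Section SeminormTheory.
Context (R : realType) (X : tvsType R).
Implicit Types (p q : X -> R) (x y : X).

Lemma seminorm0 p : seminorm p -> p 0 = 0.
Proof. by case=> _ /(_ 0 0); rewrite scale0r normr0 mul0r. Qed.

Lemma seminormN p x : seminorm p -> p (- x) = p x.
Proof. by case=> _ /(_ (-1) x); rewrite scaleN1r normrN1 mul1r. Qed.

Lemma seminorm_ge0 p x : seminorm p -> 0 <= p x.
Proof.
move=> sp; have [+ _] := sp => /(_ x (- x)).
by rewrite subrr seminorm0// seminormN//; lra.
Qed.

Lemma seminormB p x y : seminorm p -> p (x - y) = p (y - x).
Proof. by move=> sp; rewrite -seminormN// opprB. Qed.

Lemma ler_seminormB p x y : seminorm p -> p (x - y) <= p x + p y.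
Proof. by move=> sp; rewrite -(seminormN y sp); apply: sp.1. Qed.

Lemma ler_dist_seminorm p x y : seminorm p -> `|p x - p y| <= p (x - y).
Proof.
move=> sp; have [pD _] := sp; rewrite ler_norml; apply/andP; split.
  by have := pD (y - x) x; rewrite subrK (seminormB y)//; lra.
by have := pD (x - y) y; rewrite subrK; lra.
Qed.

Lemma continuous_translate (f : X -> R) x : continuous f ->
  continuous (fun y => f (y - x)).
Proof.
move=> cf y; apply: (@continuous_comp X X R (fun z => z - x) f); last exact: cf.
apply: (@continuous_comp X (X * X)%type X (fun z => (z, - x)) (fun z => z.1 + z.2)).
  by apply: cvg_pair; [exact: cvg_id|exact: cvg_cst].
exact: add_continuous.
Qed.

Lemma lipschitz_continuous p (f : X -> R) : seminorm p -> continuous p ->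
  (forall x y, `|f x - f y| <= p (x - y)) -> continuous f.
Proof.
move=> sp cp fp x; apply/cvgrPdist_lt => e e0.
have cx := @continuous_translate p x cp x.
have := cvgr_lt _ cx; rewrite /= subrr (seminorm0 sp) => /(_ _ _ e0) cxe.
by apply: filterS cxe => y; apply: le_lt_trans; rewrite distrC.
Qed.

Lemma seminorm_add p q : seminorm p -> seminorm q -> seminorm (p \+ q).
Proof.
move=> [pD pZ] [qD qZ]; split=> [x y|a x] /=.
  by rewrite addrACA lerD.
by rewrite pZ qZ mulrDr.
Qed.

Lemma seminorm_linear (f : {linear X -> R^o}) : seminorm (fun x => `|f x|).
Proof.
split=> [x y|a x]; first by rewrite linearD ler_normD.
by rewrite linearZ /= normrM.
Qed.

Lemma seminorm_bounded_continuous p (f : {linear X -> R^o}) :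
  seminorm p -> continuous p -> (forall x, `|f x| <= p x) ->
  continuous (f : X -> R).
Proof.
move=> sp cp fp; apply: (lipschitz_continuous sp cp) => x y.
by rewrite -linearB; exact: fp.
Qed.

End SeminormTheory.

(** * The Hahn-Banach theorem through minimal sublinear functionals *)

Section HahnBanach.
Context (R : realType) (X : lmodType R).
Implicit Types (p q : X -> R) (x y : X).

(** Homogeneity is restricted to nonnegative factors because the slopes below are not symmetric,
    even when [p] is a seminorm. *)
Definition sublinear p :=
  (forall x y, p (x + y) <= p x + p y) /\
  (forall (a : R) x, 0 <= a -> p (a *: x) = a * p x).

Lemma sublinear0 p : sublinear p -> p 0 = 0.
Proof. by case=> _ /(_ 0 0 (lexx 0)); rewrite scale0r mul0r. Qed.

Lemma sublinear_ge p x : sublinear p -> - p (- x) <= p x.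
Proof.
by move=> sp; have := sp.1 x (- x); rewrite subrr sublinear0//; lra.
Qed.

(** A lower bound common to all sublinear functionals below [q]; it keeps infima of chains
    finite. *)
Lemma sublinear_lb p q x : sublinear p -> (forall y, p y <= q y) ->
  - q (- x) <= p x.
Proof.
by move=> sp pq; have := sublinear_ge x sp; have := pq (- x); lra.
Qed.

Definition slope_set p y x :=
  [set s | exists2 t : R, 0 <= t & s = p (x + t *: y) - t * p y].

(* The largest sublinear functional below [p] that sends [- y] to at most
   [- p y]. *)
Definition slope p y x : R := inf (slope_set p y x).

Lemma slope_has_inf p y x : sublinear p -> has_inf (slope_set p y x).
Proof.
move=> sp; have [pD pZ] := sp; split; first by exists (p (x + 0 *: y) - 0 * p y), 0.
exists (- p (- x)) => _ [t t0 ->].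
by have := pD (x + t *: y) (- x); rewrite addrAC subrr add0r pZ//; lra.
Qed.

Lemma slope_le p y x (t : R) : sublinear p -> 0 <= t ->
  slope p y x <= p (x + t *: y) - t * p y.
Proof.
by move=> sp t0; apply: ge_inf; [have [] := slope_has_inf y x sp|exists t].
Qed.

Lemma slope_ler p y x : sublinear p -> slope p y x <= p x.
Proof.
move=> sp; have := slope_le y x sp (lexx 0).
by rewrite scale0r addr0 mul0r subr0.
Qed.

Lemma slopeN p y : sublinear p -> slope p y (- y) <= - p y.
Proof.
move=> sp; have := slope_le y (- y) sp ler01.
by rewrite scale1r addNr sublinear0// mul1r sub0r.
Qed.

(** Parameters [s] for [x] and [t] for [z] combine into [s + t] for [x + z]; scaling the vector by
    [b > 0] rescales the parameter by [b]. *)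
Lemma slope_sublinear p y : sublinear p -> sublinear (slope p y).
Proof.
move=> sp; have [pD pZ] := sp; split=> [x z|a x a0].
  rewrite -lerBlDr; apply: lb_le_inf; first by have [] := slope_has_inf y x sp.
  move=> _ [s s0 ->]; rewrite lerBlDr -lerBlDl.
  apply: lb_le_inf; first by have [] := slope_has_inf y z sp.
  move=> _ [t t0 ->]; rewrite lerBlDl.
  have := slope_le y (x + z) sp (addr_ge0 s0 t0).
  have := pD (x + s *: y) (z + t *: y).
  by rewrite addrACA -scalerDl; lra.
have := a0; rewrite le_eqVlt => /predU1P[<-|{}a0].
  rewrite scale0r mul0r; apply/eqP; rewrite eq_le; apply/andP; split.
    by have := slope_ler y 0 sp; rewrite (sublinear0 sp).
  apply: lb_le_inf; first by have [] := slope_has_inf y 0 sp.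
  by move=> _ [t t0 ->]; rewrite add0r pZ// subrr.
have aN0 : a != 0 by rewrite gt_eqF.
(* One inequality suffices: the reverse one is this one for [a^-1] at [a *: x]. *)
have le_slope (b : R) z : 0 < b -> b * slope p y z <= slope p y (b *: z).
  move=> b0; apply: lb_le_inf; first by have [] := slope_has_inf y (b *: z) sp.
  move=> _ [t t0 ->].
  have -> : b *: z + t *: y = b *: (z + (b^-1 * t) *: y).
    by rewrite scalerDr scalerA mulrA divff ?gt_eqF// mul1r.
  rewrite (pZ _ _ (ltW b0)).
  have -> : t * p y = b * ((b^-1 * t) * p y) by rewrite !mulrA divff ?mul1r// gt_eqF.
  rewrite -mulrBr ler_pM2l//; apply: slope_le => //.
  by rewrite mulr_ge0// invr_ge0 ltW.
apply/eqP; rewrite eq_le le_slope// andbT.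
have := le_slope a^-1 (a *: x); rewrite invr_gt0 => /(_ a0).
by rewrite scalerA mulVf// scale1r ler_pdivrMl.
Qed.

(** Zorn's lemma; the pointwise infimum of a nonempty chain is again sublinear. *)
Lemma minimal_sublinear p : sublinear p -> exists q : X -> R,
  [/\ sublinear q, forall x, q x <= p x &
      forall r, sublinear r -> (forall x, r x <= q x) -> r = q].
Proof.
move=> sp.
pose T := {q : X -> R | sublinear q /\ forall x, q x <= p x}.
(* The order is reversed, so that a maximal element is a minimal functional. *)
pose leT (q r : T) := `[< forall x, sval r x <= sval q x >].
have sP (q : T) : sublinear (sval q) by have [] := svalP q.
have pP (q : T) : forall x, sval q x <= p x by have [] := svalP q.
have eqT (q r : T) : sval q = sval r -> q = r.
  by case: q r => [q q'] [r r'] /= qr; subst r; congr exist; exact: Prop_irrelevance.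
have [q|q r s /asboolP qr /asboolP rs|q r /asboolP qr /asboolP rq||q minq] := @Zorn T leT.
- exact/asboolP.
- by apply/asboolP => x; exact: le_trans (rs x) (qr x).
- by apply: eqT; apply/funext => x; apply/eqP; rewrite eq_le rq qr.
- move=> A Atot; have [A0|/set0P[a0 Aa0]] := eqVneq A set0.
    by exists (exist _ p (conj sp (fun x => lexx (p x)))) => s; rewrite A0.
  pose V x := [set sval a x | a in A].
  have hV x : has_inf (V x).
    split; first by exists (sval a0 x), a0.
    by exists (- p (- x)) => _ [a _ <-]; apply: sublinear_lb.
  pose g x := inf (V x).
  have gle a x : A a -> g x <= sval a x.
    by move=> Aa; apply: ge_inf; [have [] := hV x|exists a].
  have sg : sublinear g.
    split=> [x y|a x a0'].
      rewrite -lerBlDr; apply: lb_le_inf; first by have [] := hV x.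
      move=> _ [a Aa <-]; rewrite lerBlDr -lerBlDl.
      apply: lb_le_inf; first by have [] := hV y.
      move=> _ [b Ab <-]; rewrite lerBlDl.
      (* The smaller of the two functionals is used at both points; this is where the chain
         condition enters. *)
      have [/asboolP ab|/asboolP ba] := Atot _ _ Aa Ab.
        have := gle b (x + y) Ab; have := (sP b).1 x y; have := ab x; lra.
      have := gle a (x + y) Aa; have := (sP a).1 x y; have := ba y; lra.
    have Va : V (a *: x) = [set a * r | r in V x].
      apply/seteqP; split=> [_ [b Ab <-]|_ [_ [b Ab <-] <-]] /=.
        by exists (sval b x); [exists b|rewrite (sP b).2].
      by exists b => //; rewrite (sP b).2.
    rewrite /g Va; have := a0'; rewrite le_eqVlt => /predU1P[<-|{}a0'].
      rewrite mul0r (_ : [set _ | _ in _] = [set 0]) ?inf1//.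
      apply/seteqP; split=> [_ [r _ <-]|_ ->] /=; first by rewrite mul0r.
      by exists (sval a0 x); [exists a0|rewrite mul0r].
    apply/eqP; rewrite eq_le; apply/andP; split.
      rewrite -ler_pdivrMl//; apply: lb_le_inf; first by have [] := hV x.
      move=> r Vr; rewrite ler_pdivrMl//; apply: ge_inf; last by exists r.
      have [_ [l lV]] := hV x; exists (a * l) => _ [s Vs <-].
      by rewrite ler_pM2l//; exact: lV.
    apply: lb_le_inf; first by exists (a * sval a0 x), (sval a0 x) => //; exists a0.
    by move=> _ [_ [b Ab <-] <-]; rewrite ler_pM2l//; exact: gle.
  have gp x : g x <= p x := le_trans (gle _ _ Aa0) (pP a0 x).
  by exists (exist _ g (conj sg gp)) => a Aa; apply/asboolP => x /=; exact: gle.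
- exists (sval q); split => // r sr rq.
  have rp x : r x <= p x := le_trans (rq x) (pP q x).
  by have /(congr1 sval) := minq (exist _ r (conj sr rp)) (asboolT rq).
Qed.

(* A minimal sublinear functional is linear, since it equals its slopes. *)
Lemma hahn_banach p x0 : sublinear p ->
  exists2 f : {linear X -> R^o}, f x0 = p x0 & forall x, f x <= p x.
Proof.
(* Minimality is taken below the slope at [x0] rather than below [p]: this forces
   [q (- x0) <= - p x0], hence equality at [x0] once [q] is odd. *)
move=> sp; have [q [sq qs qmin]] := minimal_sublinear (slope_sublinear x0 sp).
have qN y : q (- y) = - q y.
  have qy : slope q y = q.
    by apply: qmin; [exact: slope_sublinear|move=> x; exact: slope_ler].
  apply/eqP; rewrite eq_le; apply/andP; split; first by rewrite -{1}qy slopeN.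
  by have := sublinear_ge (- y) sq; rewrite opprK.
have qD x y : q (x + y) = q x + q y.
  apply/eqP; rewrite eq_le sq.1 /=.
  by have := sq.1 (x + y) (- y); rewrite addrK qN; lra.
have qlin : linear (q : X -> R^o).
  move=> a x y; rewrite qD; congr (_ + _).
  have [a0|a0] := leP 0 a; first exact: sq.2.
  by rewrite -{1}[a]opprK scaleNr qN sq.2 ?oppr_ge0 ?ltW// mulNr opprK.
pose L := GRing.isLinear.Build _ _ _ _ (q : X -> R^o) qlin.
pose f : {linear X -> R^o} := HB.pack (q : X -> R^o) L.
have fp x : q x <= p x := le_trans (qs x) (slope_ler _ _ sp).
exists f => //=; apply/eqP; rewrite eq_le fp/=.
by have := qs (- x0); have := slopeN x0 sp; rewrite qN; lra.
Qed.

End HahnBanach.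

Lemma hahn_banach_seminorm (R : realType) (X : tvsType R) (p : X -> R) x0 :
  seminorm p ->
  exists2 f : {linear X -> R^o}, f x0 = p x0 & forall x, `|f x| <= p x.
Proof.
move=> sp; have [pD pZ] := sp.
have [|f fx0 fp] := @hahn_banach R X p x0.
  by split=> // a x a0; rewrite pZ ger0_norm.
exists f => // x; rewrite ler_norml fp andbT lerNl -linearN.
by rewrite -(seminormN x sp).
Qed.

(** * Minkowski gauges: continuous seminorms generate the topology *)

Section Gauge.
Context (R : realType) (X : tvsType R).

(** A convex basic neighbourhood is intersected with its reflection, so that its gauge will be
    even. *)
Lemma convex_symmetric_nbhs (U : set X) : nbhs 0 U -> exists V : set X,
  [/\ nbhs 0 V, V `<=` U, forall x, V x -> V (- x) &
      forall x y (t : R), V x -> V y -> 0 <= t <= 1 -> V (t *: x + (1 - t) *: y)].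
Proof.
move=> U0; have [B Bc [Bo Bb]] := @locally_convex R X.
have [b [Bbb b0] bU] := Bb 0 U U0.
have bc x y (t : R) : b x -> b y -> 0 <= t <= 1 -> b (t *: x + (1 - t) *: y).
  move=> bx by_ /andP[t0 t1].
  have := Bc b (mem_set Bbb) x y (Itv01 t0 t1) (mem_set bx) (mem_set by_).
  by rewrite inE.
have nb : nbhs 0 b by apply: open_nbhs_nbhs; split => //; exact: Bo.
exists (b `&` (-%R @` b)); split.
- by apply: filterI => //; exact: nbhs0N.
- by move=> x [/bU].
- move=> x [bx [y by_ yx]]; split; last by exists x.
  by rewrite -yx opprK.
- move=> x y t [bx [x' bx' xE]] [by_ [y' by' yE]] t01; split; first exact: bc.
  exists (t *: x' + (1 - t) *: y'); first exact: bc.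
  by rewrite -xE -yE opprD !scalerN.
Qed.

Lemma gauge_seminorm (U : set X) : nbhs 0 U -> exists p : X -> R,
  [/\ seminorm p, continuous p & [set x | p x < 1] `<=` U].
Proof.
move=> /convex_symmetric_nbhs[V [V0 VU VN Vc]].
pose G x := [set t : R | 0 < t /\ V (t^-1 *: x)].
have V00 : V 0 by exact: nbhs_singleton.
have shrink x (t : R) : V x -> 0 <= t <= 1 -> V (t *: x).
  by move=> Vx t01; have := Vc x 0 t Vx V00 t01; rewrite scaler0 addr0.
(* Scalar multiplication is continuous at 0, so small multiples of [x] lie in [V]; without this the
   infimum [p x] would be taken over an empty set. *)
have absorb x : exists t, G x t.
  have : (fun t : R^o => t *: x) @ (0 : R^o) --> (0 : X).
    rewrite (_ : (0 : X) = (0 : R^o) *: x); last by rewrite scale0r.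
    apply: (@continuous_comp _ (R^o * X)%type _ (fun t => (t, x)) (fun z => z.1 *: z.2)).
      by apply: (@cvg_pair _ _ _ _ (nbhs (0 : R^o))); [exact: cvg_id|exact: cvg_cst].
    exact: scale_continuous.
  move=> /(_ V V0); rewrite nbhs_filterE => /nbhs_ballP[/= e e0 be].
  exists (e / 2)^-1; split; first by rewrite invr_gt0 divr_gt0.
  rewrite invrK; apply: (be (e / 2)).
  by rewrite -ball_normE /ball_/= sub0r normrN gtr0_norm ?divr_gt0//; lra.
have Ginf x : has_inf (G x).
  split; [exact: absorb|by exists 0 => t [/ltW]].
pose p x := inf (G x).
have p_ge0 x : 0 <= p x.
  by apply: lb_le_inf; [exact: absorb|move=> t [/ltW]].
have ple x t : G x t -> p x <= t by move=> Gt; apply: ge_inf => //; have [] := Ginf x.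
have plt x (t : R) : p x < t -> G x t.
  rewrite -subr_gt0 => /inf_adherent/(_ (Ginf x))[s [s0 Vs]].
  rewrite -/(p x) addrC subrK => st; have t0 := lt_trans s0 st; split => //.
  have -> : t^-1 *: x = (t^-1 * s) *: (s^-1 *: x).
    by rewrite scalerA -mulrA divff ?mulr1// gt_eqF.
  apply: shrink => //; rewrite mulr_ge0 ?invr_ge0 ?(ltW t0) ?(ltW s0)//=.
  by rewrite ler_pdivrMl// mulr1 ltW.
have pN x : p (- x) = p x.
  rewrite /p; congr inf; apply/seteqP; split=> t [t0 Vt]; split => //.
    by rewrite -[x]opprK scalerN; exact: VN.
  by rewrite scalerN; exact: VN.
have pZle (a : R) x : 0 < a -> p (a *: x) <= a * p x.
  move=> a0; rewrite -ler_pdivrMl//; apply: lb_le_inf; first exact: absorb.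
  move=> t [t0 Vt]; rewrite ler_pdivrMl//; apply: ple; split; first exact: mulr_gt0.
  by rewrite scalerA invfM mulrC mulrA divff ?gt_eqF// mul1r.
have pZ0 (a : R) x : 0 < a -> p (a *: x) = a * p x.
  move=> a0; apply/eqP; rewrite eq_le pZle//=.
  have := @pZle a^-1 (a *: x); rewrite invr_gt0 => /(_ a0).
  by rewrite scalerA mulVf ?gt_eqF// scale1r ler_pdivlMl.
have p0 : p 0 = 0.
  apply/eqP; rewrite eq_le p_ge0 andbT; apply/ler_addgt0Pr => e e0.
  by rewrite add0r; apply: ple; split => //; rewrite scaler0.
have sp : seminorm p.
  split=> [x y|a x].
    apply/ler_addgt0Pr => e e0.
    have e20 : 0 < e / 2 by rewrite divr_gt0.
    have [|s0 Vs] := plt x (p x + e / 2); first by rewrite ltrDl.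
    have [|t0 Vt] := plt y (p y + e / 2); first by rewrite ltrDl.
    set s := p x + e / 2 in s0 Vs; set t := p y + e / 2 in t0 Vt.
    have -> : p x + p y + e = s + t by rewrite /s /t; lra.
    have st0 : 0 < s + t by rewrite addr_gt0.
    apply: ple; split => //.
    (* A convex combination of two points of [V], with weights proportional to [s] and [t]. *)
    have -> : (s + t)^-1 *: (x + y) =
        (s / (s + t)) *: (s^-1 *: x) + (1 - s / (s + t)) *: (t^-1 *: y).
      rewrite !scalerA scalerDr; congr (_ *: _ + _ *: _); field; lra.
    apply: Vc => //; rewrite divr_ge0 ?(ltW s0) ?(ltW st0)//= ler_pdivrMr// mul1r; lra.
  have [a0|a0|->] := ltgtP a 0; last by rewrite scale0r p0 normr0 mul0r.
    by rewrite ltr0_norm// -[a]opprK scaleNr pN pZ0 ?oppr_gt0// !opprK.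
  by rewrite gtr0_norm// pZ0.
exists p; split => //; last first.
  by move=> x /= /plt[_]; rewrite invr1 scale1r => /VU.
move=> x; apply/cvgrPdist_lt => e e0.
have e20 : 0 < e / 2 by rewrite divr_gt0.
(* On the neighbourhood [x + (e / 2) V] the gauge varies by at most [e / 2]. *)
have /(nbhsT x) : nbhs 0 ( *:%R (e / 2) @` V) by apply: nbhs0Z => //; rewrite gt_eqF.
apply: filterS => _ [_ [z Vz <-] <-].
apply: le_lt_trans (ler_dist_seminorm _ _ sp) _.
rewrite opprD addNKr pN pZ0//.
have : p z <= 1 by apply: ple; split => //; rewrite invr1 scale1r.
by move=> pz; apply: le_lt_trans (ler_wpM2l (ltW e20) pz) _; lra.
Qed.

Lemma nbhs_seminorm (x : X) (U : set X) : nbhs x U -> exists p : X -> R,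
  [/\ seminorm p, continuous p & [set y | p (y - x) < 1] `<=` U].
Proof.
move=> Ux; have /gauge_seminorm[p [sp cp pU]] : nbhs 0 [set y | U (x + y)].
  have := nbhsB (- x) Ux; rewrite addNr; apply: filterS => _ [y Uy <-] /=.
  by rewrite addNKr.
by exists p; split => // y /pU /=; rewrite addrC subrK.
Qed.

End Gauge.

(** * Integration against a signed measure *)

Section SignedIntegral.
Context (R : realType) (d : measure_display) (T : measurableType d).
Implicit Type nu : {charge set T -> \bar R}.

Section Difference.
Variables (nu : {charge set T -> \bar R}) (m1 m2 : {measure set T -> \bar R}).
Hypothesis fm1 : forall A, measurable A -> m1 A \is a fin_num.
Hypothesis fm2 : forall A, measurable A -> m2 A \is a fin_num.
Hypothesis nuE : forall A, measurable A -> nu A = (m1 A - m2 A)%E.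

Let pos := jordan_pos (hahn_posnegP nu).
Let neg := jordan_neg (hahn_posnegP nu).

Let mP : measurable (hahn_pos nu). Proof. by have [[]] := hahn_posnegP nu. Qed.
Let mN : measurable (hahn_neg nu). Proof. by have [_ []] := hahn_posnegP nu. Qed.

Lemma jordan_pos_le A : measurable A -> (pos A <= m1 A)%E.
Proof.
move=> mA; rewrite /pos jordan_posE cjordan_posE /crestr0 mem_set// /crestr nuE; last first.
  exact: measurableI.
rewrite (@le_trans _ _ (m1 (A `&` hahn_pos nu)))//.
  by rewrite leeBlDr ?leeDl// fm2//; exact: measurableI.
by apply: le_measure => //; rewrite ?inE//; exact: measurableI.
Qed.

Lemma jordan_neg_le A : measurable A -> (neg A <= m2 A)%E.
Proof.
move=> mA; rewrite /neg jordan_negE cjordan_negE /crestr0 mem_set// /crestr nuE; last first.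
  exact: measurableI.
have mAN : measurable (A `&` hahn_neg nu) by exact: measurableI.
rewrite (@le_trans _ _ (m2 (A `&` hahn_neg nu)))//; last first.
  by apply: le_measure => //; rewrite ?inE.
by rewrite fin_num_oppeB ?fm2// addeC leeBlDr ?fm1// leeDl.
Qed.

Lemma jordan_addE A : measurable A ->
  (measure_add pos m2 A = measure_add neg m1 A)%E.
Proof.
move=> mA; rewrite !measure_addE; change (pos A + m2 A = neg A + m1 A)%E.
have : (m1 A - m2 A = pos A - neg A)%E.
  by rewrite -nuE// (jordan_decomp (hahn_posnegP nu) mA) /cadd/= cscaleN1.
have fp : pos A \is a fin_num by rewrite fin_num_measure.
have fn : neg A \is a fin_num by rewrite fin_num_measure.
move: (fm1 mA) (fm2 mA) fp fn.
move: (m1 A) (m2 A) (pos A) (neg A) => [a| |] [b| |] [c| |] [e| |]// _ _ _ _ [abce].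
by rewrite -!EFinD; congr (_%:E); lra.
Qed.

(** Any decomposition into finite measures computes the integral, not only the Jordan one:
    [pos + m2] and [neg + m1] are the same measure, and all four integrals are finite because the
    Jordan parts are dominated by [m1] and [m2]. *)
Lemma cintegral_difference f :
  m1.-integrable setT (EFin \o f) -> m2.-integrable setT (EFin \o f) ->
  cintegral nu f = \int[m1]_x f x - \int[m2]_x f x.
Proof.
move=> i1 i2.
have mf : measurable_fun setT (EFin \o f) by case/integrableP : i1.
have le_int (m m' : {measure set T -> \bar R}) :
    (forall A, measurable A -> m A <= m' A)%E ->
    m'.-integrable setT (EFin \o f) -> m.-integrable setT (EFin \o f).
  move=> mm' /integrableP[_ i']; apply/integrableP; split => //.
  apply: le_lt_trans i'; apply: ge0_le_measure_integral => //.
  exact: measurableT_comp.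
have ip := le_int _ _ jordan_pos_le i1.
have in_ := le_int _ _ jordan_neg_le i2.
have : (\int[measure_add pos m2]_x (f x)%:E = \int[measure_add neg m1]_x (f x)%:E)%E.
  by apply: eq_measure_integral => A mA _; exact: jordan_addE.
rewrite integral_measure_add//= integral_measure_add//=.
have := integrable_fin_num measurableT ip; have := integrable_fin_num measurableT in_.
have := integrable_fin_num measurableT i1; have := integrable_fin_num measurableT i2.
rewrite /cintegral /Rintegral -/pos -/neg /=.
move: (integral m1 _ _) (integral m2 _ _) (integral pos _ _) (integral neg _ _).
move=> [a| |] [b| |] [c| |] [e| |]//= _ _ _ _ [abce]; lra.
Qed.

End Difference.

Lemma abs_charge_integrable nu (f : T -> R) :
  (abs_charge nu).-integrable setT (EFin \o f) ->
  (jordan_pos (hahn_posnegP nu)).-integrable setT (EFin \o f) /\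
  (jordan_neg (hahn_posnegP nu)).-integrable setT (EFin \o f).
Proof.
move=> /integrableP[mf i]; have mf' : measurable_fun setT (fun x => `|(f x)%:E|%E).
  exact: measurableT_comp.
split; apply/integrableP; split => //; apply: le_lt_trans i.
  apply: (@ge0_le_measure_integral _ _ _ _ (charge_variation (hahn_posnegP nu))) => //.
  by move=> A mA; rewrite /charge_variation leeDl.
apply: (@ge0_le_measure_integral _ _ _ _ (charge_variation (hahn_posnegP nu))) => //.
by move=> A mA; rewrite /charge_variation leeDr.
Qed.

Lemma cintegralB nu1 nu2 (f : T -> R) :
  (abs_charge nu1).-integrable setT (EFin \o f) ->
  (abs_charge nu2).-integrable setT (EFin \o f) ->
  cintegral (cadd nu1 (copp nu2)) f = cintegral nu1 f - cintegral nu2 f.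
Proof.
move=> /abs_charge_integrable[p1 n1] /abs_charge_integrable[p2 n2].
have mf : measurable_fun setT (EFin \o f) by case/integrableP : p1.
set a1 := jordan_pos (hahn_posnegP nu1) in p1 *.
set b1 := jordan_neg (hahn_posnegP nu1) in n1 *.
set a2 := jordan_pos (hahn_posnegP nu2) in p2 *.
set b2 := jordan_neg (hahn_posnegP nu2) in n2 *.
have add_int (m m' : {measure set T -> \bar R}) :
    m.-integrable setT (EFin \o f) -> m'.-integrable setT (EFin \o f) ->
    (measure_add m m').-integrable setT (EFin \o f).
  move=> /integrableP[_ i] /integrableP[_ i']; apply/integrableP; split => //.
  rewrite ge0_integral_measure_add//; first exact: lte_add_pinfty.
  exact: measurableT_comp.
have add_fin (m m' : {finite_measure set T -> \bar R}) A :
    measurable A -> measure_add m m' A \is a fin_num.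
  by move=> mA; rewrite measure_addE fin_numD !fin_num_measure.
(* The Jordan parts of a difference are not computable from those of the terms, but
   [(a1 + b2) - (b1 + a2)] is a decomposition of it. *)
rewrite (@cintegral_difference _ (measure_add a1 b2) (measure_add b1 a2)).
- have := integrable_fin_num measurableT p1; have := integrable_fin_num measurableT n1.
  have := integrable_fin_num measurableT p2; have := integrable_fin_num measurableT n2.
  rewrite /cintegral /Rintegral !integral_measure_add//= -/a1 -/a2 -/b1 -/b2.
  move: (integral a1 _ _) (integral b1 _ _) (integral a2 _ _) (integral b2 _ _).
  by move=> [a| |] [b| |] [c| |] [e| |]//= _ _ _ _; lra.
- by move=> A mA; exact: add_fin.
- by move=> A mA; exact: add_fin.
- move=> A mA.
  transitivity ((a1 A + b2 A) - (b1 A + a2 A))%E; last first.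
    by rewrite -(measure_addE a1 b2 A) -(measure_addE b1 a2 A).
  transitivity (nu1 A - nu2 A)%E => //.
  have -> : nu1 A = (a1 A - b1 A)%E.
    by rewrite (jordan_decomp (hahn_posnegP nu1) mA) /cadd/= cscaleN1.
  have -> : nu2 A = (a2 A - b2 A)%E.
    by rewrite (jordan_decomp (hahn_posnegP nu2) mA) /cadd/= cscaleN1.
  have : a1 A \is a fin_num by rewrite fin_num_measure.
  have : b1 A \is a fin_num by rewrite fin_num_measure.
  have : a2 A \is a fin_num by rewrite fin_num_measure.
  have : b2 A \is a fin_num by rewrite fin_num_measure.
  move: (a1 A) (b1 A) (a2 A) (b2 A).
  move=> [a| |] [b| |] [c| |] [e| |]//= _ _ _ _.
  by rewrite -!EFinD; congr (_%:E); lra.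
- exact: add_int.
- exact: add_int.
Qed.

Lemma ler_abs_cintegral nu (f g : T -> R) : measurable_fun setT f ->
  (abs_charge nu).-integrable setT (EFin \o g) ->
  (forall x, `|f x| <= g x) ->
  (abs_charge nu).-integrable setT (EFin \o f) /\
  `|cintegral nu f| <= fine (\int[abs_charge nu]_x (g x)%:E)%E.
Proof.
move=> mf ig fg.
have g0 x : 0 <= g x by apply: le_trans (fg x).
have le_int (m : {measure set T -> \bar R}) : m.-integrable setT (EFin \o g) ->
    m.-integrable setT (EFin \o f) /\ `|\int[m]_x f x| <= \int[m]_x g x.
  move=> mg; have mi : m.-integrable setT (EFin \o f).
    apply: le_integrable mg => //; first exact/measurable_EFinP.
    by move=> x _; rewrite /= lee_fin (ger0_norm (g0 x)).
  split => //; apply: le_trans (le_normr_Rintegral _ mi) _ => //.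
  apply: le_Rintegral => //.
  by have := integrable_abse mi; apply: eq_integrable.
have [p n] := abs_charge_integrable ig.
have [_ p'] := le_int _ p; have [_ n'] := le_int _ n.
split; first by have [] := le_int (charge_variation (hahn_posnegP nu)) ig.
have -> : (\int[abs_charge nu]_x (g x)%:E =
    \int[measure_add (jordan_pos (hahn_posnegP nu)) (jordan_neg (hahn_posnegP nu))]_x
      (g x)%:E)%E.
  apply: (@eq_measure_integral _ _ _ _ _ (charge_variation (hahn_posnegP nu))) => A mA _.
  transitivity (jordan_pos (hahn_posnegP nu) A + jordan_neg (hahn_posnegP nu) A)%E => //.
  by rewrite -(measure_addE (jordan_pos _) (jordan_neg _)).
rewrite integral_measure_add//= fineD; last 2 first.
  exact: (integrable_fin_num measurableT p).
  exact: (integrable_fin_num measurableT n).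
by apply: le_trans (ler_normB _ _) _; exact: lerD.
Qed.

Section NonNegative.
Variables (nu : {charge set T -> \bar R}) (m : {finite_measure set T -> \bar R}).
Hypothesis nuE : forall A, measurable A -> nu A = m A.

(** By minimality of the Jordan decomposition, compared with [m - 0]. *)
Lemma jordan_neg_eq0 A : measurable A -> jordan_neg (hahn_posnegP nu) A = 0%E.
Proof.
move=> mA; apply/eqP; rewrite eq_le measure_ge0 andbT.
apply: (@jordan_neg_le nu m mzero) => // [B mB|B mB]; first exact: fin_num_measure.
by rewrite nuE// sube0.
Qed.

Lemma abs_chargeE A : measurable A -> abs_charge nu A = m A.
Proof.
move=> mA; rewrite /abs_charge /charge_variation jordan_neg_eq0// adde0 -nuE//.
rewrite (jordan_decomp (hahn_posnegP nu) mA) /cadd/= cscaleN1.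
by have /= -> := jordan_neg_eq0 mA; rewrite sube0.
Qed.

Lemma integrable_abs_charge (f : T -> \bar R) :
  (abs_charge nu).-integrable setT f <-> m.-integrable setT f.
Proof.
have abs_int : (\int[abs_charge nu]_x `|f x| = \int[m]_x `|f x|)%E.
  by apply: (@eq_measure_integral _ _ _ _ _ (charge_variation (hahn_posnegP nu))) => A mA _;
     exact: abs_chargeE.
by split=> /integrableP[mf i]; apply/integrableP; split; rewrite // ?abs_int// -abs_int.
Qed.

Lemma cintegralE (f : T -> R) : m.-integrable setT (EFin \o f) ->
  cintegral nu f = \int[m]_x f x.
Proof.
move=> i; rewrite (@cintegral_difference nu m mzero)//.
- by rewrite {2}/Rintegral integral_measure_zero subr0.
- by move=> A mA; exact: fin_num_measure.
- by move=> A mA; rewrite nuE// sube0.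
- apply/integrableP; split; first by case/integrableP : i.
  by rewrite integral_measure_zero.
Qed.

End NonNegative.

End SignedIntegral.

Section Borel.
Context (R : realType) (X : tvsType R).

Lemma open_borel (U : set X) : open U -> measurable (U : set (borel X)).
Proof. by move=> oU; exact: sub_sigma_algebra. Qed.

Lemma continuous_borel_map (f : X -> X) : continuous f ->
  measurable_fun setT (f : borel X -> borel X).
Proof.
move=> cf; apply (@measurability _ _ (borel X) (borel X) setT f (@open X)) => //.
move=> _ [U oU <-]; rewrite setTI; apply: open_borel.
by apply: open_comp => // x _; exact: cf.
Qed.

Lemma closed_borel (U : set X) : closed U -> measurable (U : set (borel X)).
Proof.
by move=> cU; rewrite -[U]setCK; apply: measurableC; apply: open_borel; exact: closed_openC.
Qed.

Lemma continuous_borel (f : X -> R) : continuous f ->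
  measurable_fun setT (f : borel X -> R).
Proof.
move=> cf; apply: (measurability _ (RGenOpens.measurableE R)) => //.
move=> _ [_ [a [b ->] <-]]; rewrite setTI; apply: open_borel.
by apply: open_comp => // x _; exact: cf.
Qed.

Lemma superlevel_borel (f : X -> R) (t : R) : continuous f ->
  measurable ([set x | t < f x] : set (borel X)).
Proof.
move=> cf; apply: open_borel.
by apply: (@open_comp _ _ f [set r | t < r]) => [x _|]; [exact: cf|exact: open_gt].
Qed.

Lemma bounded_integrable (m : {finite_measure set (borel X) -> \bar R}) (f : X -> R)
  (M : R) : continuous f -> (forall x, `|f x| <= M) ->
  m.-integrable setT (EFin \o (f : borel X -> R)).
Proof.
move=> cf fM; apply: measurable_bounded_integrable => //.
- by rewrite ltey_eq fin_num_measure.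
- exact: continuous_borel.
- by exists M; split; [exact: num_real|move=> N MN x _; apply: le_trans (fM x) (ltW MN)].
Qed.

End Borel.

(** * Tails and integrals *)

(** Read off the definition of the integral as a supremum over simple functions, so that it applies
    to the slice function [y |-> P (B - y)] of a convolution, whose measurability is never
    established. *)
Lemma le_integral_pos d (T : measurableType d) (R : realType)
    (m : {measure set T -> \bar R}) (f g : T -> \bar R) :
  (forall x, 0 <= f x)%E -> (forall x, f x <= g x)%E ->
  (\int[m]_x f x <= \int[m]_x g x)%E.
Proof.
move=> f0 fg; have g0 x : (0 <= g x)%E by exact: le_trans (fg x).
rewrite !ge0_integralTE//; apply: le_ereal_sup => _ [h hf <-].
by exists h => // x; exact: le_trans (fg x).
Qed.

Lemma integral_ge_two_levels d (T : measurableType d) (R : realType)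
    (m : {measure set T -> \bar R}) (g : T -> \bar R) (A B : set T) (a b : R) :
  measurable A -> measurable B -> A `&` B = set0 -> 0 <= a -> 0 <= b ->
  (forall x, 0 <= g x)%E ->
  (forall x, A x -> a%:E <= g x)%E -> (forall x, B x -> b%:E <= g x)%E ->
  (a%:E * m A + b%:E * m B <= \int[m]_x g x)%E.
Proof.
move=> mA mB AB a0 b0 g0 gA gB.
have mi (c : R) (C : set T) : measurable C ->
    measurable_fun setT (fun x => c%:E * (\1_C x)%:E)%E.
  move=> mC; rewrite (_ : (fun x => _) = EFin \o (fun x => c * \1_C x))//.
  by apply/measurable_EFinP; apply: measurable_funM.
have ii (c : R) (C : set T) : 0 <= c -> measurable C ->
    (\int[m]_x (c%:E * (\1_C x)%:E) = c%:E * m C)%E.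
  move=> c0 mC; rewrite ge0_integralZl_EFin//; last first.
    by apply/measurable_EFinP; exact: measurable_indic.
  by rewrite integral_indic// setIT.
rewrite -!ii// -ge0_integralD//; last 4 first.
- by move=> x _; rewrite mule_ge0// lee_fin.
- exact: mi.
- by move=> x _; rewrite mule_ge0// lee_fin.
- exact: mi.
apply: le_integral_pos => x; first by rewrite adde_ge0// mule_ge0// lee_fin.
rewrite !indicE; have [xA|xA] := boolP (x \in A).
  rewrite memNset ?mule0 ?adde0 ?mule1; first by apply: gA; exact/set_mem.
  move=> xB; have : (A `&` B) x by split => //; exact/set_mem.
  by rewrite AB.
rewrite mule0 add0e; have [xB|xB] := boolP (x \in B); last by rewrite mule0.
by rewrite mule1; apply: gB; exact/set_mem.
Qed.

(** A layer-cake bound along the levels [lam ^+ (N + n) * s]: each gap between consecutive levels is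
    charged with the probability of exceeding its lower end, which gives a geometric series of ratio
    [lam * kap]. *)
Lemma geometric_tail_integral d (T : measurableType d) (R : realType)
    (P : probability T R) (q : T -> R) (lam kap s : R) (N : nat) :
  measurable_fun setT q -> 1 < lam -> 0 <= kap -> lam * kap < 1 -> 0 < s ->
  (forall n, P [set x | (lam ^+ n * s < q x)%R] <= (kap ^+ n)%:E)%E ->
  (\int[P]_x (Num.max (q x - lam ^+ N * s)%R 0%R)%:E <=
    ((lam - 1) * s * (lam * kap) ^+ N / (1 - lam * kap))%R%:E)%E.
Proof.
move=> mq lam1 kap0 lk1 s0 tail.
have lam0 : 0 < lam by lra.
have lk0 : 0 <= lam * kap by rewrite mulr_ge0// ltW.
pose A n := [set x | lam ^+ (N + n) * s < q x].
have mA n : measurable (A n).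
  have := mq measurableT `]lam ^+ (N + n) * s, +oo[%classic (measurable_itv _).
  rewrite setTI; congr measurable; apply/seteqP; split=> x /=;
    by rewrite in_itv/= andbT.
(* The distance from level [N + n] to level [N + n + 1]. *)
pose a n := (lam - 1) * (lam ^+ (N + n) * s).
have a0 n : 0 <= a n.
  by rewrite /a mulr_ge0 ?mulr_ge0 ?exprn_ge0 ?subr_ge0 ?ltW.
pose g n x : \bar R := ((a n)%:E * (\1_(A n) x)%:E)%E.
have g0 n x : (0 <= g n x)%E by rewrite mule_ge0// lee_fin.
have mi n : measurable_fun setT (fun x => (\1_(A n) x)%:E : \bar R).
  by apply/measurable_EFinP; exact: measurable_indic.
have mg n : measurable_fun setT (g n).
  rewrite (_ : g n = EFin \o (fun x => a n * \1_(A n) x))//.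
  by apply/measurable_EFinP; apply: measurable_funM.
have qg x : ((Num.max (q x - lam ^+ N * s)%R 0%R)%:E <= \sum_(n <oo) g n x)%E.
  (* The excess truncated at level [N + k] is covered by the first [k] gaps; the truncation
     disappears once that level is above [q x]. *)
  have partial k : Num.min (q x) (lam ^+ (N + k) * s) - lam ^+ N * s <=
      \sum_(0 <= n < k) a n * \1_(A n) x.
    elim: k => [|k ih].
      by rewrite big_geq// addn0 subr_le0 ge_min lexx orbT.
    rewrite big_nat_recr//=; have ak := a0 k.
    have lk : lam ^+ (N + k.+1) * s = lam ^+ (N + k) * s + a k.
      by rewrite addnS exprS /a; ring.
    rewrite {}lk; move: ih; rewrite indicE; case: (boolP (x \in A k)) => xA.
      have {xA} : lam ^+ (N + k) * s < q x by move/set_mem: xA.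
      move: (lam ^+ (N + k) * s) => c cq; rewrite (min_idPr (ltW cq)) mulr1.
      have : Num.min (q x) (c + a k) <= c + a k by rewrite ge_min lexx orbT.
      lra.
    have {xA} : q x <= lam ^+ (N + k) * s.
      by rewrite leNgt; apply: contra xA => ?; exact/mem_set.
    move: (lam ^+ (N + k) * s) => c qc; rewrite (min_idPl qc) mulr0 addr0.
    by rewrite (min_idPl _)//; lra.
  have [k qk] : exists k, q x <= lam ^+ (N + k) * s.
    have c0 : 0 < `|q x| + 1 by rewrite ltr_wpDl.
    have lamV : `|lam^-1| < 1 by rewrite gtr0_norm ?invr_gt0// invf_lt1.
    have /cvgrPdist_lt/(_ (s / (`|q x| + 1)))[|k _ /(_ _ (leqnn _)) /=] := cvg_expr lamV.
      by rewrite divr_gt0.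
    rewrite sub0r normrN normrX gtr0_norm ?invr_gt0// exprVn => ks.
    exists k; rewrite exprD -mulrA; apply: (@le_trans _ _ (lam ^+ k * s)).
      have : lam ^+ k * (`|q x| + 1) * lam ^- k < lam ^+ k * (`|q x| + 1) * (s / (`|q x| + 1)).
        by rewrite ltr_pM2l// mulr_gt0// exprn_gt0.
      rewrite mulrAC divff ?mul1r ?expf_neq0 ?gt_eqF//.
      rewrite -mulrA (mulrCA _ s) divff ?mulr1 ?gt_eqF//.
      by have := ler_norm (q x); lra.
    by rewrite ler_peMl ?exprn_ege1 ?(ltW lam1)// mulr_ge0 ?exprn_ge0 ?(ltW s0) ?(ltW lam0).
  apply: (@le_trans _ _ (\sum_(0 <= n < k) g n x)%E); last first.
    by apply: nneseries_lim_ge => n _ _; exact: g0.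
  rewrite (_ : (\sum_(0 <= n < k) g n x)%E = (\sum_(0 <= n < k) a n * \1_(A n) x)%:E).
    rewrite lee_fin ge_max; apply/andP; split.
      by have := partial k; rewrite (min_idPl qk).
    by apply: sumr_ge0 => n _; rewrite mulr_ge0.
  by rewrite sumEFin.
apply: (@le_trans _ _ (\int[P]_x \sum_(n <oo) g n x)%E).
  by apply: le_integral_pos => // x; rewrite lee_fin le_max lexx orbT.
rewrite integral_nneseries//.
apply: lime_le; first by apply: is_cvg_nneseries => n _ _; exact: integral_ge0.
apply: nearW => k.
apply: (@le_trans _ _ (\sum_(0 <= n < k) ((lam - 1) * s * (lam * kap) ^+ (N + n))%:E)%E).
  apply: lee_sum => n _; rewrite /g ge0_integralZl_EFin//.
  rewrite integral_indic// setIT.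
  apply: le_trans (lee_wpmul2l _ (tail (N + n)%N)) _; first by rewrite lee_fin.
  by rewrite -EFinM lee_fin /a exprMn; lra.
rewrite sumEFin lee_fin.
have geo : (1 - lam * kap) * (\sum_(0 <= n < k) (lam * kap) ^+ n) = 1 - (lam * kap) ^+ k.
  elim: k => [|k ih]; first by rewrite big_geq// expr0 mulr0 subrr.
  by rewrite big_nat_recr//= mulrDr ih exprS; ring.
rewrite ler_pdivlMr ?subr_gt0//.
under eq_bigr do rewrite exprD mulrA.
rewrite -mulr_sumr -[leLHS]mulrA (mulrC _ (1 - lam * kap)) geo.
rewrite ler_piMr// ?mulr_ge0 ?exprn_ge0 ?subr_ge0 ?(ltW lam1) ?(ltW s0)//.
by rewrite gerBl exprn_ge0.
Qed.

(** * Sums of two independent copies of a stable vector *)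

(** The assumption [1 < p1] acts through the strict bound below 2, which is uniform over all orders
    above [p1]. *)
Lemma pow2_inv_bounds (R : realType) (p1 p : R) : 1 < p1 -> p1 < p ->
  [/\ 1 < (2 : R) `^ p1^-1, (2 : R) `^ p1^-1 < 2, 1 < (2 : R) `^ p^-1 &
      (2 : R) `^ p^-1 <= 2 `^ p1^-1].
Proof.
move=> p11 p1p; have p10 : 0 < p1 by lra.
have p0 : 0 < p by lra.
have l2 : 0 < ln (2 : R) by rewrite ln_gt0// ltr1n.
have powE (x : R) : (2 : R) `^ x = expR (x * ln 2) by rewrite /powR pnatr_eq0.
split; rewrite ?powE.
- by rewrite expR_gt1 mulr_gt0 ?invr_gt0.
- have {2}<- : expR (ln 2) = 2 :> R by rewrite lnK// posrE.
  by rewrite ltr_expR gtr_pMl// invf_lt1.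
- by rewrite expR_gt1 mulr_gt0 ?invr_gt0.
- by rewrite ler_expR ler_pM2r// lef_pV2 ?posrE// ltW.
Qed.

Section StableSum.
Context (R : realType) (X : tvsType R).
Implicit Types (P : probability (borel X) R) (q : X -> R).

(* The sum of two independent copies of [xi] has the law of [c xi + v]. *)
Definition stable_sum P (c : R) (v : X) :=
  forall B : set (borel X), measurable B ->
    P ([set x : X | B (c *: x + v)] : set (borel X)) =
    (\int[P]_y P ([set x : X | B (x + (y : X))%R] : set (borel X)))%E.

Lemma stable_stable_sum (p : R) P : stable p P ->
  exists v, stable_sum P (2 `^ p^-1) v.
Proof.
move=> [p02 /(_ 1 1 ltr01 ltr01)[v Pv]]; exists v => B mB.
have affine1 : affine_image P 1 0 = P.
  apply/funext => C; rewrite /affine_image /pushforward; congr (P _).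
  by apply/seteqP; split=> x; rewrite /= scale1r addr0.
have := Pv B mB; rewrite affine1 powR1.
by rewrite (_ : 1 + 1 = 2 :> R)//; lra.
Qed.

Lemma affine_continuous (c : R) (v : X) : continuous (fun x : X => c *: x + v).
Proof.
move=> x; apply: (@continuous_comp X (X * X)%type X
    (fun x => (c *: x, v)) (fun z => z.1 + z.2)); last exact: add_continuous.
apply: cvg_pair; last exact: cvg_cst.
apply: (@continuous_comp X (R^o * X)%type X (fun x => (c, x)) (fun z => z.1 *: z.2)).
  by apply: (@cvg_pair _ _ _ _ (nbhs (c : R^o))); [exact: cvg_cst|exact: cvg_id].
exact: scale_continuous.
Qed.

Lemma measurable_affine_preimage (c : R) (v : X) (B : set (borel X)) :
  measurable B -> measurable ([set x : X | B (c *: x + v)] : set (borel X)).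
Proof.
move=> mB; have := continuous_borel_map (@affine_continuous c v) measurableT mB.
by rewrite setTI.
Qed.

Lemma sublevelE q (t : R) : [set x | q x <= t] = ~` [set x | t < q x].
Proof. by apply/seteqP; split=> x /=; rewrite leNgt => /negP. Qed.

Lemma sublevel_borel q (t : R) : continuous q ->
  measurable ([set x | q x <= t] : set (borel X)).
Proof.
by move=> cq; rewrite sublevelE; apply: measurableC; exact: superlevel_borel.
Qed.

Lemma probability_sublevel P q (t r : R) : continuous q ->
  (P ([set x | (t < q x)%R] : set (borel X)) <= r%:E)%E ->
  ((1 - r)%:E <= P ([set x | (q x <= t)%R] : set (borel X)))%E.
Proof.
move=> cq Pr; rewrite sublevelE probability_setC; last exact: superlevel_borel.
by rewrite EFinB leeB.
Qed.

Section Tail.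
Variables (P : probability (borel X) R) (c : R) (v : X).
Hypothesis Pcv : stable_sum P c v.

(** Both copies lie in [A] with probability at least 9/16, so [c xi + v] lies in [G] at least that
    often, while [xi] misses [A] with probability at most 1/4. A common point [x] then locates the
    vector [v]. *)
Lemma stable_sum_meets (A G : set (borel X)) : measurable A -> measurable G ->
  (forall x y : X, A x -> A y -> G (x + y)) -> ((3 / 4)%:E <= P A)%E ->
  exists x : X, A x /\ G (c *: x + v).
Proof.
move=> mA mG AG PA; apply: contrapT => /forallNP noA.
pose H : set (borel X) := [set x : X | G (c *: x + v)].
have mH : measurable H by exact: measurable_affine_preimage.
have HA : H `<=` ~` A by move=> x Hx Ax; apply: (noA x).
have : (P H <= P (~` A))%E.
  by apply: le_measure => //; rewrite inE//; exact: measurableC.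
rewrite probability_setC//.
(* The two-level bound with an empty second set: for [y] in [A], the slice of [G] contains [A]. *)
have : ((3 / 4)%:E * P A + 0%:E * P set0 <= P H)%E.
  rewrite (Pcv mG); apply: integral_ge_two_levels => //.
  - by rewrite setI0.
  - move=> x Ax; apply: le_trans PA _; apply: le_measure; rewrite ?inE//.
      have := measurable_affine_preimage 1 x mG.
      by congr measurable; apply/seteqP; split=> y /=; rewrite scale1r.
    by move=> y Ay; exact: AG.
rewrite mul0e adde0.
have fA := fin_num_measure P _ mA; have fH := fin_num_measure P _ mH.
move: PA; rewrite -(fineK fA) -(fineK fH).
move: (fine (P A)) (fine (P H)) => a h.
by rewrite -EFinM -EFinB !lee_fin; lra.
Qed.

(** At a point [x] with [q x <= T] and [q (c x + v) <= 2 T], the difference [v = (c x + v) - c x]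
    costs at most [2 T + 2 T]. *)
Lemma stable_sum_shift q (T : R) : seminorm q -> continuous q -> 0 < c <= 2 ->
  (P ([set x | (T < q x)%R] : set (borel X)) <= (1 / 4)%:E)%E -> q v <= 4 * T.
Proof.
move=> sq cq /andP[c0 c2] PT.
have [||||x [/= xT]] := @stable_sum_meets [set x : X | q x <= T] [set x : X | q x <= 2 * T].
- exact: sublevel_borel.
- exact: sublevel_borel.
- by move=> x y /= xT yT; apply: le_trans (sq.1 _ _) _; lra.
- by apply: le_trans (probability_sublevel cq PT); rewrite lee_fin; lra.
move=> cxT; have -> : v = (c *: x + v) - c *: x by rewrite addrAC subrr add0r.
apply: le_trans (ler_seminormB _ _ sq) _.
rewrite (sq.2 c x) gtr0_norm//.
have : c * q x <= 2 * T by rewrite ler_pM// ?(ltW c0)// seminorm_ge0.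
by move: (c * q x) cxT => a b; lra.
Qed.

(* The sum of two independent copies is large as soon as one of them is large
   and the other is not, and these two events are disjoint. *)
Lemma stable_sum_tail q (t e dlt : R) : seminorm q -> continuous q ->
  0 < t -> 0 < e < 1 / 2 -> 0 <= dlt < 1 -> 0 < c -> q v <= e * t ->
  (P ([set x | (e * t < q x)%R] : set (borel X)) <= dlt%:E)%E ->
  ((2 * (1 - dlt))%:E * P ([set x | (t < q x)%R] : set (borel X)) <=
   P ([set x | ((1 - 2 * e) * t / c < q x)%R] : set (borel X)))%E.
Proof.
move=> sq cq t0 /andP[e0 e12] /andP[d0 d1] c0 qv Pe.
pose A : set (borel X) := [set x | t < q x].
pose B : set (borel X) := [set x | q x <= e * t].
have mA : measurable A by exact: superlevel_borel.
have mB : measurable B by exact: sublevel_borel.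
have PB : ((1 - dlt)%:E <= P B)%E by exact: probability_sublevel.
have AB : A `&` B = set0.
  apply/seteqP; split=> // x [xA xB].
  have {}xA : t < q x by []; have {}xB : q x <= e * t by [].
  have : e * t <= t by rewrite ler_piMl ?(ltW t0)//; lra.
  by lra.
(* One loss of [e * t] comes from the small copy; removing the shift [v] costs another, which
   explains [1 - 2 * e] in the conclusion. *)
pose G : set (borel X) := [set x | (1 - e) * t < q x].
have mG : measurable G by exact: superlevel_borel.
have sumG x y : A x -> B y -> G (x + y).
  move=> xA yB; have := ler_seminormB (x + y) y sq; rewrite addrK.
  by rewrite /A/B/G/= in xA yB *; lra.
have finA := fin_num_measure P _ mA.
have mslice (y : X) : measurable ([set x : X | G (x + y)] : set (borel X)).
  have := measurable_affine_preimage 1 y mG.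
  by congr measurable; apply/seteqP; split=> z /=; rewrite scale1r.
apply: (@le_trans _ _ (P [set x : X | G (c *: x + v)])); last first.
  apply: le_measure; rewrite ?inE.
  - exact: measurable_affine_preimage.
  - exact: superlevel_borel.
  move=> x; rewrite /G/= => Gx; rewrite ltr_pdivrMr//.
  have := sq.1 (c *: x) v; rewrite sq.2 gtr0_norm// mulrC.
  by move: (q x * c) => a; lra.
rewrite (Pcv mG).
(* For [y] in [A] the slice of [G] contains [B]; for [y] in [B] it contains [A]. Each case
   contributes at least [(1 - dlt) * P A]. *)
apply: (@le_trans _ _ ((1 - dlt)%:E * P A + (fine (P A))%:E * P B)%E).
  rewrite fineK// muleC (muleC (P A)).
  apply: (@le_trans _ _ ((1 - dlt)%:E * P A + (1 - dlt)%:E * P A)%E).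
    by rewrite -ge0_muleDl ?lee_fin ?subr_ge0 ?(ltW d1)// -EFinD muleC; apply: lee_wpmul2r => //; rewrite lee_fin; lra.
  by rewrite leeD2l// lee_wpmul2r.
apply: integral_ge_two_levels => //.
- by rewrite subr_ge0 ltW.
- by rewrite fine_ge0.
- move=> y Ay; apply: le_trans PB _; apply: le_measure; rewrite ?inE//.
  by move=> x Bx /=; rewrite addrC; exact: sumG.
- move=> y By; rewrite fineK//; apply: le_measure; rewrite ?inE//.
  by move=> x Ax /=; exact: sumG.
Qed.

End Tail.

(* The tail of [q] decays by [kap] under dilation by [lam], where [lam * kap < 1]
   because [c1 < 2]. *)
Lemma stable_sum_uniform_tail (c1 : R) : 1 < c1 < 2 ->
  exists dlt lam kap a : R,
  [/\ 0 < dlt <= 1 / 4, 1 < lam, 0 <= kap, lam * kap < 1 & 0 < a] /\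
  forall P (c : R) (v : X) q (T : R), stable_sum P c v -> 1 < c <= c1 ->
    seminorm q -> continuous q -> 0 < T ->
    (P ([set x | (T < q x)%R] : set (borel X)) <= dlt%:E)%E ->
    forall n, (P ([set x | (lam ^+ n * (a * T) < q x)%R] : set (borel X)) <=
      (kap ^+ n)%:E)%E.
Proof.
move=> /andP[c11 c12].
(* Chosen so that [lam * kap = c1 / (2 (1 - eta)^2)] is below 1: indeed
   [(1 - eta)^2 >= 1 - 2 eta > c1 / 2]. *)
pose eta := (1 - c1 / 2) / 4.
have eta0 : 0 < eta by rewrite /eta; lra.
have eta14 : eta < 1 / 4 by rewrite /eta; lra.
pose e := eta / 2; pose lam := c1 / (1 - 2 * e); pose kap := (2 * (1 - eta))^-1.
have e0 : 0 < e by rewrite /e; lra.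
have e2 : 1 - 2 * e = 1 - eta by rewrite /e; lra.
have lam1 : 1 < lam by rewrite /lam e2 ltr_pdivlMr; lra.
have kap0 : 0 < kap by rewrite /kap invr_gt0; lra.
(* The factor [4 / e] makes [e] times the initial level equal to [4 * T], which dominates both [q v]
   and [T]. *)
exists eta, lam, kap, (4 / e); split; first split.
- by apply/andP; split => //; lra.
- by [].
- exact: ltW.
- rewrite /lam /kap e2 -mulrA -invfM ltr_pdivrMr; last by apply: mulr_gt0; lra.
  have : 0 <= eta * eta by rewrite mulr_ge0 ?(ltW eta0).
  by rewrite mul1r /eta; lra.
- by rewrite divr_gt0.
move=> P c v q T Pcv /andP[c1' cc1] sq cq T0 PT.
have c0 : 0 < c by lra.
have qv : q v <= 4 * T.
  apply: (stable_sum_shift Pcv sq cq); first by apply/andP; split; lra.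
  by apply: le_trans PT _; rewrite lee_fin; lra.
elim=> [|n ih]; first by rewrite expr0 mul1r expr0; exact: probability_le1 (superlevel_borel _ cq).
set s := lam ^+ n * (4 / e * T) in ih.
have s4 : 4 * T <= e * s.
  rewrite /s (_ : e * _ = lam ^+ n * (4 * T)); last by field; lra.
  by rewrite ler_peMl ?exprn_ege1 ?(ltW lam1)//; lra.
have s0 : 0 < s by rewrite -(pmulr_rgt0 _ e0); lra.
have ls : e * s <= e * (lam * s).
  by rewrite ler_pM2l// ler_peMl ?(ltW lam1) ?(ltW s0).
(* Applied at level [lam * s], where [(1 - 2 e) lam s / c = c1 s / c >= s] brings the tail back to
   the previous level. *)
have := @stable_sum_tail P c v Pcv q (lam * s) e eta sq cq.
rewrite (_ : lam ^+ n.+1 * _ = lam * s); last by rewrite /s exprS -mulrA.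
move=> H; have {}H := H (mulr_gt0 (lt_trans ltr01 lam1) s0).
have kapE : 2 * (1 - eta) = kap^-1 by rewrite invrK.
rewrite exprS EFinM -lee_pdivrMl//.
rewrite -kapE.
apply: (@le_trans _ _ (P [set x | ((1 - 2 * e) * (lam * s) / c < q x)%R])).
  apply: H => //.
  - by apply/andP; split; lra.
  - by apply/andP; split; lra.
  - by lra.
  apply: le_trans PT; apply: le_measure; rewrite ?inE; try exact: superlevel_borel.
  by move=> x /=; lra.
apply: le_trans ih; apply: le_measure; rewrite ?inE; try exact: superlevel_borel.
move=> x /=; apply: le_lt_trans.
rewrite ler_pdivlMr// /lam e2 -e2.
rewrite (_ : (1 - 2 * e) * (c1 / (1 - 2 * e) * s) = c1 * s).
  by rewrite mulrC ler_pM2r.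
by field; lra.
Qed.

(** The order of quantifiers is the point: [dlt] depends on [c1] alone, and [S] is chosen before the
    law, its scale, its shift and the seminorm. *)
Lemma stable_sum_uniformly_integrable (c1 : R) : 1 < c1 < 2 ->
  exists2 dlt : R, 0 < dlt & forall T eta : R, 0 < T -> 0 < eta ->
  exists S : R, forall P (c : R) (v : X) q, stable_sum P c v -> 1 < c <= c1 ->
    seminorm q -> continuous q ->
    (P ([set x | (T < q x)%R] : set (borel X)) <= dlt%:E)%E ->
    (\int[P]_x (Num.max (q x - S)%R 0%R)%:E <= eta%:E)%E.
Proof.
move=> /stable_sum_uniform_tail[dlt [lam [kap [a [[/andP[d0 _] lam1 kap0 lk1 a0] tail]]]]].
exists dlt => // T eta T0 eta0.
have aT0 : 0 < a * T by rewrite mulr_gt0.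
have lam0 : 0 < lam by lra.
have : `|lam * kap| < 1 by rewrite ger0_norm// mulr_ge0// ltW.
pose C := (lam - 1) * (a * T) / (1 - lam * kap).
have C0 : 0 < C by rewrite /C !mulr_gt0 ?invr_gt0 ?subr_gt0.
move=> /cvg_expr/cvgrPdist_lt/(_ (eta / C))[|N _ /(_ N (leqnn N)) /=].
  by rewrite divr_gt0.
rewrite sub0r normrN => lkN.
exists (lam ^+ N * (a * T)) => P c v q Pcv cc1 sq cq PT.
apply: le_trans (geometric_tail_integral N (continuous_borel cq) lam1 kap0 lk1 aT0 _) _.
  exact: tail Pcv cc1 sq cq T0 PT.
rewrite lee_fin (_ : _ / _ = C * (lam * kap) ^+ N); last by rewrite /C mulrAC.
rewrite mulrC -ler_pdivlMr//.
by apply: le_trans (ler_norm _) _; exact: ltW.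
Qed.

End StableSum.

Section SeminormIntegrability.
Context (R : realType) (X : tvsType R).
Implicit Types (m : {finite_measure set (borel X) -> \bar R}) (q : X -> R).

Lemma continuous_excess q (S : R) : continuous q ->
  continuous (fun x => Num.max (q x - S) 0).
Proof.
move=> cq x; apply: (@continuous_max R X (fun x => q x - S) (fun=> 0)); last exact: cvg_cst.
by apply: cvgB; [exact: cq|exact: cvg_cst].
Qed.

Lemma excess_integrable m q (S : R) : continuous q -> (forall x, 0 <= q x) ->
  (\int[m]_x (Num.max (q x - S)%R 0%R)%:E < +oo)%E ->
  m.-integrable setT (EFin \o (q : borel X -> R)).
Proof.
move=> cq q0 qS.
have iS : m.-integrable setT (EFin \o ((fun x => Num.max (q x - S) 0) : borel X -> R)).
  apply/integrableP; split.
    by apply/measurable_EFinP; apply: continuous_borel; exact: continuous_excess.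
  under eq_integral do rewrite /= ger0_norm ?le_max ?lexx ?orbT//.
  exact: qS.
have ic := finite_measure_integrable_cst m `|S|.
have := integrableD measurableT (ic setT measurableT) iS; apply: le_integrable => //.
  by apply/measurable_EFinP; exact: continuous_borel.
move=> x _ /=; rewrite lee_fin ger0_norm//.
have m0 : 0 <= Num.max (q x - S) 0 by rewrite le_max lexx orbT.
have : q x - S <= Num.max (q x - S) 0 by rewrite le_max lexx.
rewrite ger0_norm ?addr_ge0//.
have := ler_norm S; lra.
Qed.

Lemma superlevel_small m q (e : R) : continuous q -> 0 < e ->
  exists2 T : R, 0 < T & (m ([set x | (T < q x)%R] : set (borel X)) <= e%:E)%E.
Proof.
move=> cq e0; pose A n : set (borel X) := [set x | n%:R < q x].
have mA n : measurable (A n) by exact: superlevel_borel.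
have A0 : \bigcap_n A n = set0.
  apply/seteqP; split=> // x Ax.
  have : `|q x| < (Num.bound `|q x|)%:R by exact: archi_boundP.
  have := Ax (Num.bound `|q x|) I; rewrite /A /= => xq /lt_trans/(_ xq).
  by rewrite ltNge ler_norm.
have : m \o A @ \oo --> m (\bigcap_n A n).
  apply: nonincreasing_cvg_mu => //.
  - by rewrite ltey_eq fin_num_measure.
  - by rewrite A0.
  - move=> n k nk; apply/subsetPset => x; rewrite /A/=.
    by apply: le_lt_trans; rewrite ler_nat.
rewrite A0 measure0 => /fine_cvgP[_ /cvgrPdist_lt/(_ _ e0)[n _ /(_ n.+1 (leqnSn n))]].
rewrite /= sub0r normrN => mA1; exists n.+1%:R => //.
have fA : m (A n.+1) \is a fin_num by exact: fin_num_measure.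
by rewrite -/(A n.+1) -(fineK fA) lee_fin; apply: le_trans (ler_norm _) (ltW mA1).
Qed.

End SeminormIntegrability.

Lemma integral_probability_cst d (T : measurableType d) (R : realType)
    (P : probability T R) (a : \bar R) : (\int[P]_x a = a)%E.
Proof.
by rewrite -[RHS]mule1 -(@probability_setT _ _ _ P); exact: integral_cst.
Qed.

(** * The mean of a stable law under a functional *)

Section Mean.
Context (R : realType) (X : tvsType R).
Variables (P : probability (borel X) R) (c : R) (v : X).
Hypothesis Pcv : stable_sum P c v.

Lemma integral_prod_fst (f : borel X -> R) : P.-integrable setT (EFin \o f) ->
  (P \x P)%E.-integrable setT (fun z : borel X * borel X => (f z.1)%:E) /\
  (\int[P \x P]_z (f z.1)%:E = \int[P]_x (f x)%:E)%E.
Proof.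
move=> /[dup] fi /integrableP[mf fy].
have mf1 : measurable_fun setT (fun z : borel X * borel X => (f z.1)%:E).
  exact: (measurableT_comp mf measurable_fst).
have i1 : (P \x P)%E.-integrable setT (fun z : borel X * borel X => (f z.1)%:E).
  apply/integrable12ltyP => //.
  under eq_integral do rewrite /= integral_probability_cst.
  exact: fy.
split => //; rewrite -integral12_prod_meas1//.
by apply: eq_integral => x _; rewrite /fubini_F /= integral_probability_cst.
Qed.

Lemma integral_prod_snd (f : borel X -> R) : P.-integrable setT (EFin \o f) ->
  (P \x P)%E.-integrable setT (fun z : borel X * borel X => (f z.2)%:E) /\
  (\int[P \x P]_z (f z.2)%:E = \int[P]_x (f x)%:E)%E.
Proof.
move=> /[dup] fi /integrableP[mf fy].
have mf1 : measurable_fun setT (fun z : borel X * borel X => (f z.2)%:E).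
  exact: (measurableT_comp mf measurable_snd).
have i1 : (P \x P)%E.-integrable setT (fun z : borel X * borel X => (f z.2)%:E).
  apply/integrable12ltyP => //=.
  by rewrite integral_probability_cst.
split => //; rewrite -integral12_prod_meas1//.
by rewrite /fubini_F /= integral_probability_cst.
Qed.

(** Taking expectations of [f (c xi + v)] and [f xi + f xi'] gives [c E f + f v = 2 E f]. The
    function [f x + f y] is measurable on the product, though [x + y] need not be; so the two laws
    are compared on the line. *)
Lemma stable_sum_mean (f : {linear X -> R^o}) : continuous (f : X -> R) ->
  P.-integrable setT (EFin \o (f : borel X -> R)) ->
  f v = (2 - c) * \int[P]_x (f : borel X -> R) x.
Proof.
move=> cf fi; pose g : borel X -> R := f.
have mg : measurable_fun setT g by exact: continuous_borel.
pose h : borel X -> R := fun x => f (c *: (x : X) + v).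
have hE x : h x = c * g x + f v by rewrite /h linearD linearZ.
pose k : borel X * borel X -> R := fun z => g z.1 + g z.2.
have mh : measurable_fun setT h.
  apply: continuous_borel => x.
  apply: (@continuous_comp X X R (fun x => c *: x + v) f); last exact: cf.
  exact: affine_continuous.
have mk : measurable_fun setT k.
  apply: measurable_funD.
    exact: (measurableT_comp mg measurable_fst).
  exact: (measurableT_comp mg measurable_snd).
have [i1 e1] := integral_prod_fst fi; have [i2 e2] := integral_prod_snd fi.
have hi : P.-integrable setT (EFin \o h).
  have := integrableD measurableT (integrableZl measurableT c fi)
    (finite_measure_integrable_cst P (f v) measurableT).
  by apply: eq_integrable => // x _ /=; rewrite hE.
have ki : (P \x P)%E.-integrable setT (EFin \o k).
  have := integrableD measurableT i1 i2.
  by apply: eq_integrable => // x _ /=.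
have hk : (\int[P]_x (h x)%:E = \int[P \x P]_z (k z)%:E)%E.
  have := @integral_pushforward _ _ _ _ R h mh P setT EFin.
  rewrite preimage_setT => <- //.
  have := @integral_pushforward _ _ _ _ R k mk (P \x P)%E setT EFin.
  rewrite preimage_setT => <- //.
  apply: eq_measure_integral => Z mZ _; rewrite /pushforward.
  have mgZ : measurable (g @^-1` Z) by rewrite -[X in measurable X]setTI; exact: mg.
  transitivity (\int[P]_y P ([set x : X | (g @^-1` Z) (x + (y : X))%R] : set (borel X)))%E.
    exact: (Pcv mgZ).
  rewrite /product_measure1; apply: eq_integral => y _; congr (P _).
  apply/seteqP; split=> x; rewrite /xsection/= ?inE /k /g /= linearD addrC ?mem_setE//.
have : \int[P]_x h x = \int[P]_x g x + \int[P]_x g x.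
  rewrite /Rintegral hk (_ : (\int[_]_z _)%E = (\int[P \x P]_z ((g z.1)%:E + (g z.2)%:E))%E)//.
  rewrite integralD// -/g e1 e2 fineD//; exact: (integrable_fin_num measurableT fi).
have -> : \int[P]_x h x = c * \int[P]_x g x + f v.
  rewrite (eq_Rintegral _ (g := fun x => c * g x + f v)); last by move=> x _; rewrite hE.
  rewrite RintegralD//.
  - by rewrite RintegralZl// {2}/Rintegral integral_probability_cst.
  - exact: (integrableZl measurableT c fi).
  - exact: finite_measure_integrable_cst.
by rewrite -/g; lra.
Qed.

End Mean.

(** * Separation of compact sets and positivity *)

Section SetDistance.
Context (R : realType) (X : tvsType R).
Implicit Types (q : X -> R) (A : set X).

Definition seminorm_dist q A (x : X) : R := inf [set q (x - a) | a in A].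

Lemma seminorm_dist_le q A x a : seminorm q -> A a ->
  seminorm_dist q A x <= q (x - a).
Proof.
move=> sq Aa; apply: ge_inf; last by exists a.
by exists 0 => _ [b _ <-]; exact: seminorm_ge0.
Qed.

Lemma seminorm_dist_lip q A x y : seminorm q -> A !=set0 ->
  seminorm_dist q A x <= seminorm_dist q A y + q (x - y).
Proof.
move=> sq [a0 Aa0]; rewrite -lerBlDr; apply: lb_le_inf.
  by exists (q (y - a0)), a0.
move=> _ [a Aa <-]; rewrite lerBlDr; apply: le_trans (seminorm_dist_le x sq Aa) _.
by have := sq.1 (y - a) (x - y); rewrite addrC addrA subrK.
Qed.

Lemma seminorm_dist_continuous q A : seminorm q -> continuous q -> A !=set0 ->
  continuous (seminorm_dist q A).
Proof.
move=> sq cq A0; apply: (lipschitz_continuous sq cq) => x y.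
rewrite ler_norml; apply/andP; split.
  by have := seminorm_dist_lip y x sq A0; rewrite (seminormB y)//; lra.
by have := seminorm_dist_lip x y sq A0; lra.
Qed.

Lemma seminorm_dist_lt q A x (r : R) : seminorm q -> A !=set0 ->
  seminorm_dist q A x < r -> exists2 a, A a & q (x - a) < r.
Proof.
move=> sq A0; have hi : has_inf [set q (x - a) | a in A].
  split; first by have [a Aa] := A0; exists (q (x - a)), a.
  by exists 0 => _ [b _ <-]; exact: seminorm_ge0.
rewrite -subr_gt0 => /inf_adherent/(_ hi)[_ [a Aa <-]].
by rewrite -/(seminorm_dist q A x) (addrC (seminorm_dist q A x)) subrK; exists a.
Qed.

Lemma seminorm_dist_ge q A x (r : R) : A !=set0 ->
  (forall a, A a -> r <= q (x - a)) -> r <= seminorm_dist q A x.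
Proof.
move=> [a Aa] rA; apply: lb_le_inf; first by exists (q (x - a)), a.
by move=> _ [b Ab <-]; exact: rA.
Qed.

Lemma seminorm_dist_mem q A x : seminorm q -> A x -> seminorm_dist q A x = 0.
Proof.
move=> sq Ax; apply/eqP; rewrite eq_le; apply/andP; split.
  by have := seminorm_dist_le x sq Ax; rewrite subrr seminorm0.
by apply: seminorm_dist_ge; [exists x|move=> a _; exact: seminorm_ge0].
Qed.

(** The compact set [L - K] misses 0, so some continuous seminorm is at least 1 on it; its distance
    to [K] then separates. *)
Lemma compact_separation (K L : set X) : hausdorff_space X -> K !=set0 ->
  compact K -> compact L -> K `&` L = set0 ->
  exists f : X -> R, [/\ continuous f, forall x, 0 <= f x <= 1,
    forall x, K x -> f x = 1 & forall x, L x -> f x = 0].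
Proof.
move=> hX K0 cK cL KL.
pose D := (fun z : X * X => z.1 - z.2) @` (L `*` K).
have cD : compact D.
  apply: continuous_compact; last exact: compact_setX.
  by apply: continuous_subspaceT; exact: sub_continuous.
have D0 : ~ D 0.
  move=> [[x y] [/= Lx Ky] /eqP]; rewrite subr_eq0 => /eqP xy.
  have : (K `&` L) x by split => //; rewrite xy.
  by rewrite KL.
have : nbhs 0 (~` D).
  by apply: open_nbhs_nbhs; split => //; apply: closed_openC; exact: compact_closed.
move=> /gauge_seminorm[q [sq cq qD]].
exists (fun x => Num.max (1 - seminorm_dist q K x) 0); split.
- move=> x; apply: (@continuous_max R X (fun x => 1 - seminorm_dist q K x) (fun=> 0)).
    apply: cvgB; first exact: cvg_cst.
    exact: seminorm_dist_continuous.
  exact: cvg_cst.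
- move=> x; rewrite le_max lexx orbT ge_max ler01 andbT gerBl.
  by apply: seminorm_dist_ge => // a _; exact: seminorm_ge0.
- by move=> x Kx; rewrite seminorm_dist_mem// subr0 (max_idPl _).
- move=> x Lx; rewrite (max_idPr _)// subr_le0.
  apply: seminorm_dist_ge => // a Ka; rewrite leNgt; apply/negP => /qD; apply.
  by exists (x, a).
Qed.

End SetDistance.

Section IndicatorIntegral.
Context (R : realType) (X : tvsType R) (m : {finite_measure set (borel X) -> \bar R}).
Implicit Types (f : X -> R) (A : set (borel X)).

Lemma integrable_Rintegral_indic A : measurable A ->
  m.-integrable setT (EFin \o (\1_A : borel X -> R)) /\
  \int[m]_x (\1_A : borel X -> R) x = fine (m A).
Proof.
move=> mA; split; last by rewrite /Rintegral integral_indic// setIT.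
apply: (@measurable_bounded_integrable _ _ _ m) => //.
  by rewrite ltey_eq fin_num_measure.
exists 1; split; first exact: num_real.
move=> r r1 x _ /=; rewrite ger0_norm//; apply: le_trans (ltW r1).
by rewrite indicE; case: (_ \in _).
Qed.

Lemma measure_le_Rintegral f A (M : R) : measurable A -> continuous f ->
  (forall x, 0 <= f x <= M) -> (forall x, A x -> 1 <= f x) ->
  fine (m A) <= \int[m]_x (f : borel X -> R) x.
Proof.
move=> mA cf fM fA; have [iA <-] := integrable_Rintegral_indic mA.
apply: le_Rintegral => //.
  by apply: (@bounded_integrable _ _ _ _ M) => // x; rewrite ger0_norm//; case/andP: (fM x).
move=> x _; rewrite indicE; have [/set_mem/fA//|_] := boolP (x \in A).
by case/andP: (fM x).
Qed.

Lemma Rintegral_le_measure f A : measurable A -> continuous f ->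
  (forall x, 0 <= f x <= 1) -> (forall x, ~ A x -> f x = 0) ->
  \int[m]_x (f : borel X -> R) x <= fine (m A).
Proof.
move=> mA cf f1 fA; have [iA <-] := integrable_Rintegral_indic mA.
apply: le_Rintegral => //.
  by apply: (@bounded_integrable _ _ _ _ 1) => // x; rewrite ger0_norm//; case/andP: (f1 x).
move=> x _; rewrite indicE; have [_|xA] := boolP (x \in A); first by case/andP: (f1 x).
by rewrite fA// => /mem_set; exact/negP.
Qed.

End IndicatorIntegral.

(** * A Radon charge that is nonnegative on continuous functions is a measure *)

Section RadonPositivity.
Context (R : realType) (X : tvsType R).
Hypothesis hX : hausdorff_space X.

Lemma compact_borel (K : set X) : compact K -> measurable (K : set (borel X)).
Proof. by move=> cK; apply: closed_borel; exact: compact_closed. Qed.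

Variable nu : {charge set (borel X) -> \bar R}.
Hypothesis radon_nu : radon (abs_charge nu).
Hypothesis nu_ge0 : forall f : X -> R, continuous f -> (forall x, 0 <= f x <= 1) ->
  0 <= cintegral nu (f : borel X -> R).

(** If the negative set [N] had negative mass [s > 0], take compact [K] in [N] and [L] off [K], each
    missing less than [s / 4]. A function equal to 1 on [K] and 0 on [L] has negative part of its
    integral above [3 s / 4] and positive part below [s / 4]. *)
Lemma radon_jordan_neg_eq0 (A : set (borel X)) : measurable A ->
  jordan_neg (hahn_posnegP nu) A = 0%E.
Proof.
move=> mA.
set pos := jordan_pos (hahn_posnegP nu); set neg := jordan_neg (hahn_posnegP nu).
have [[mP _] [mN _] PNT PN0] := hahn_posnegP nu.
set P := hahn_pos nu in mP PNT PN0; set N := hahn_neg nu in mN PNT PN0.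
have finp B : measurable B -> pos B \is a fin_num by move=> mB; exact: fin_num_measure.
have finn B : measurable B -> neg B \is a fin_num by move=> mB; exact: fin_num_measure.
have posN : pos N = 0%E.
  rewrite /pos jordan_posE cjordan_posE /crestr0 mem_set// /crestr setIC PN0.
  exact: charge0.
have negN : neg setT = neg N.
  rewrite /neg !jordan_negE !cjordan_negE /crestr0 !mem_set//.
  by rewrite /crestr setTI setIid.
apply/eqP; rewrite eq_le measure_ge0 andbT.
apply: (@le_trans _ _ (neg setT)); first by apply: le_measure; rewrite ?inE//; exact: measurableT.
rewrite negN leNgt; apply/negP => sgt0.
set s := fine (neg N).
have negNE : neg N = s%:E by rewrite fineK// finn.
have s0 : 0 < s by rewrite -lte_fin -negNE.
have s40 : 0 < s / 4 by rewrite divr_gt0.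
have le_fine (m1 : set (borel X) -> \bar R) B (r : R) :
    m1 B \is a fin_num -> (m1 B < r%:E)%E -> fine (m1 B) < r.
  by move=> fB; rewrite -{1}(fineK fB) lte_fin.
have [K [cK KN mK]] := radon_nu mN s40.
have mK' := compact_borel cK.
have [L [cL LK mL]] := radon_nu (measurableC mK') s40.
have mL' := compact_borel cL.
have posle B (r : R) : measurable B -> (abs_charge nu B < r%:E)%E -> fine (pos B) < r.
  move=> mB; rewrite /abs_charge /charge_variation => Br.
  by apply: le_fine; [exact: finp|apply: le_lt_trans Br; rewrite leeDl].
have negle B (r : R) : measurable B -> (abs_charge nu B < r%:E)%E -> fine (neg B) < r.
  move=> mB; rewrite /abs_charge /charge_variation => Br.
  by apply: le_fine; [exact: finn|apply: le_lt_trans Br; rewrite leeDr].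
have negK : 3 / 4 * s < fine (neg K).
  have := negle _ _ (measurableD mN mK') mK.
  have : neg N = (neg (N `\` K) + neg K)%E.
    rewrite -measureU//; first by rewrite setUC setDUK.
    - exact: measurableD.
    - by rewrite setDKI.
  move=> /(congr1 fine); rewrite fineD ?finn//; last exact: measurableD.
  by rewrite -/s; lra.
have K0 : K !=set0.
  apply/set0P/eqP => K0; move: negK.
  have -> : neg K = 0%E by rewrite K0; exact: measure0.
  by move=> /=; lra.
have KL : K `&` L = set0.
  by apply/seteqP; split=> // x [Kx /LK].
have [f [cf f01 fK fL]] := compact_separation hX K0 cK cL KL.
have mKL : measurable (~` K `\` L : set (borel X)).
  by apply: measurableD => //; exact: measurableC.
have mKLN : measurable ((~` K `\` L) `|` N : set (borel X)) by exact: measurableU.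
have mLC : measurable (~` L : set (borel X)) by exact: measurableC.
have posL : fine (pos (~` L)) < s / 4.
  apply: le_lt_trans (posle _ _ mKL mL).
  rewrite fine_le ?finp//.
  apply: (@le_trans _ _ (pos ((~` K `\` L) `|` N))).
    apply: le_measure; rewrite ?inE//.
    move=> x Lx; have [Kx|Kx] := pselect (K x); first by right; exact: KN.
    by left.
  by rewrite -[leRHS]adde0 -posN; exact: measureU2.
have := nu_ge0 cf f01; rewrite /cintegral -/pos -/neg.
have := @Rintegral_le_measure _ _ pos f (~` L) (measurableC mL') cf f01.
move=> /(_ _)/wrap[]; first by move=> x /contrapT; exact: fL.
have := @measure_le_Rintegral _ _ neg f K 1 mK' cf f01.
move=> /(_ _)/wrap[]; first by move=> x /fK ->.
lra.
Qed.

End RadonPositivity.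

(** * Weak limits *)

Lemma cvg_sum_seq (R : realType) (I : Type) (F : set_system I) (J : Type) (s : seq J)
    (a : J -> I -> R) (b : J -> R) : Filter F ->
  (forall k, a k i @[i --> F] --> b k) ->
  (\sum_(k <- s) a k i) @[i --> F] --> \sum_(k <- s) b k.
Proof.
move=> FF ab; elim: s => [|k s ih].
  by rewrite big_nil; under eq_cvg do rewrite big_nil; exact: cvg_cst.
by rewrite big_cons; under eq_cvg do rewrite big_cons; exact: cvgD.
Qed.

Lemma continuous_sum_seq (R : realType) (X : tvsType R) (J : Type) (s : seq J)
    (a : J -> X -> R) : (forall k, continuous (a k)) ->
  continuous (fun x => \sum_(k <- s) a k x).
Proof. by move=> ca x; apply: cvg_sum_seq => k; exact: ca. Qed.

Lemma Rintegral_sum_seq d (T : measurableType d) (R : realType)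
    (m : {measure set T -> \bar R}) (J : Type) (s : seq J) (f : J -> T -> R) :
  (forall k, m.-integrable setT (EFin \o f k)) ->
  m.-integrable setT (EFin \o (fun x => \sum_(k <- s) f k x)) /\
  \int[m]_x (\sum_(k <- s) f k x) = \sum_(k <- s) \int[m]_x f k x.
Proof.
move=> fi; elim: s => [|k s [ihi ih]].
  split.
    rewrite (_ : EFin \o _ = cst 0%E); first exact: integrable0.
    by apply/funext => x /=; rewrite big_nil.
  under eq_Rintegral do rewrite big_nil.
  by rewrite big_nil /Rintegral integral0.
split.
  have := integrableD measurableT (fi k) ihi.
  by apply: eq_integrable => // x _ /=; rewrite big_cons.
under eq_Rintegral do rewrite big_cons.
by rewrite RintegralD// ih big_cons.
Qed.

Section PartitionOfUnity.
Context (R : realType) (X : tvsType R).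
Implicit Types (q : X -> R) (K : set X).

Lemma compact_seminorm_net q K (e : R) : seminorm q -> continuous q ->
  compact K -> 0 < e -> exists s : seq X, forall x, K x ->
    exists2 k, k \in s & q (x - k) < e.
Proof.
move=> sq cq; rewrite compact_cover => /(_ X K (fun k => [set x | q (x - k) < e])).
move=> + e0 => -[k _|x Kx|s sK Ks].
- apply: (@open_comp _ _ (fun x => q (x - k)) [set r | r < e]) => [x _|].
    exact: continuous_translate.
  exact: open_lt.
- by exists x => //=; rewrite subrr seminorm0.
- by exists (finmap.enum_fset s) => x /Ks[k ks xk]; exists k.
Qed.

(** Bumps of radius [2 * e] around an [e]-net of [K] have sum at least [e] on [K]. Dividing by the
    maximum of that sum and [e] normalizes them on [K] and never divides by zero elsewhere. *)
Lemma partition_of_unity q K (e : R) : seminorm q -> continuous q ->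
  compact K -> 0 < e -> exists (s : seq X) (phi : X -> X -> R),
  [/\ forall k, continuous (phi k), forall k x, 0 <= phi k x <= 2,
      forall x, \sum_(k <- s) phi k x <= 1,
      forall x, K x -> \sum_(k <- s) phi k x = 1 &
      forall k x, phi k x * q (x - k) <= phi k x * (2 * e)].
Proof.
move=> sq cq cK e0; have [s sK] := compact_seminorm_net sq cq cK e0.
pose psi k x := Num.max (2 * e - q (x - k)) 0.
have cpsi k : continuous (psi k).
  move=> x; apply: (@continuous_max R X (fun x => 2 * e - q (x - k)) (fun=> 0)).
    by apply: cvgB; [exact: cvg_cst|exact: continuous_translate].
  exact: cvg_cst.
have psi0 k x : 0 <= psi k x by rewrite le_max lexx orbT.
pose S x := \sum_(k <- s) psi k x.
pose D x := Num.max (S x) e.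
have D0 x : 0 < D x by rewrite lt_max e0 orbT.
have cD : continuous D.
  move=> x; apply: (@continuous_max R X S (fun=> e)); last exact: cvg_cst.
  exact: continuous_sum_seq.
have sumE x : \sum_(k <- s) psi k x / D x = S x / D x by rewrite -mulr_suml.
exists s, (fun k x => psi k x / D x); split.
- move=> k x; apply: cvgM; first exact: cpsi.
  by apply: cvgV; [rewrite gt_eqF|exact: cD].
- move=> k x; rewrite divr_ge0 ?(ltW (D0 x))//= ler_pdivrMr//.
  have eD : e <= D x by rewrite le_max lexx orbT.
  apply: (@le_trans _ _ (2 * e)); last by lra.
  by rewrite /psi ge_max gerBl seminorm_ge0//=; lra.
- by move=> x; rewrite sumE ler_pdivrMr// mul1r le_max lexx.
- move=> x /sK[k ks xk]; rewrite sumE.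
  suff eS : e <= S x by rewrite /D (max_idPl eS) divff// gt_eqF// (lt_le_trans e0).
  rewrite /S (big_rem k ks)/=; apply: ler_wpDr; first exact: sumr_ge0.
  by rewrite le_max; apply/orP; left; lra.
- move=> k x; rewrite -!mulrA ![(D x)^-1 * _]mulrC !mulrA ler_pM2r ?invr_gt0//.
  rewrite /psi; have [xk|xk] := leP (2 * e - q (x - k)) 0; first by rewrite !mul0r.
  by rewrite -[leRHS]mulrA ler_pM2l//; lra.
Qed.

End PartitionOfUnity.

Section WeakLimit.
Context (R : realType) (X : tvsType R).
Context (I : Type) (F : set_system I) {FF : ProperFilter F}.
Variables (mu : I -> probability (borel X) R).
Variable M : {finite_measure set (borel X) -> \bar R}.
Hypothesis hw : forall f : X -> R, continuous f -> (exists C : R, forall x, `|f x| <= C) ->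
  (\int[mu i]_x (f : borel X -> R) x) @[i --> F] --> \int[M]_x (f : borel X -> R) x.

Lemma weak_limit_mass : M setT = 1%E.
Proof.
have fM : M setT \is a fin_num by exact: fin_num_measure.
have cst1 : continuous (fun _ : X => 1 : R) by move=> x; exact: cvg_cst.
have := hw cst1; rewrite Rintegral_cst// mul1r.
rewrite (_ : (fun i => _) = fun=> 1); last first.
  by apply/funext => i; rewrite /Rintegral integral_probability_cst.
move=> /(_ (ex_intro _ 1 (fun=> _)))/wrap[]; first by rewrite normr1.
move=> /(cvg_unique _ (cvg_cst (1 : R))) M1.
by rewrite -(fineK fM) -M1.
Qed.

(** The continuous cutoff [h] lies between the indicators of [q > T + 1] and [q > T], at the price
    of one unit in the level. *)
Lemma weak_limit_tail q (e : R) : continuous q -> 0 < e ->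
  exists2 T : R, 0 < T & \forall i \near F,
    (mu i ([set x | (T < q x)%R] : set (borel X)) <= e%:E)%E.
Proof.
move=> cq e0; have e20 : 0 < e / 2 by rewrite divr_gt0.
have [T T0 MT] := superlevel_small M cq e20.
pose h x := Num.min (Num.max (q x - T) 0) 1.
have ch : continuous h.
  move=> x; apply: (@continuous_min R X (fun x => Num.max (q x - T) 0) (fun=> 1)).
    exact: continuous_excess.
  exact: cvg_cst.
have h01 x : 0 <= h x <= 1.
  by rewrite /h le_min ler01 andbT le_max lexx orbT ge_min lexx orbT.
exists (T + 1); first by rewrite addr_gt0.
have : \int[M]_x (h : borel X -> R) x < e.
  have := @Rintegral_le_measure _ _ M h [set x | T < q x] (superlevel_borel T cq) ch h01.
  move=> /(_ _)/wrap[].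
    move=> x /negP; rewrite -leNgt => qT; rewrite /h (max_idPr _) ?subr_le0//.
    by rewrite (min_idPl _).
  have fT := fin_num_measure M _ (superlevel_borel T cq).
  by move: MT; rewrite -(fineK fT) lee_fin /=; lra.
have hb : exists C : R, forall x, `|h x| <= C.
  by exists 1 => x; have /andP[h0 h1] := h01 x; rewrite ger0_norm.
move=> he; have near_e : \forall i \near F, \int[mu i]_x (h : borel X -> R) x < e.
  exact: (@cvgr_lt R I F _ (fun i => \int[mu i]_x (h : borel X -> R) x) _ (hw ch hb) _ he).
apply: filterS near_e => i hi.
have fT := fin_num_measure (mu i) _ (superlevel_borel (T + 1) cq).
rewrite -(fineK fT) lee_fin; apply: le_trans (ltW hi).
apply: (@measure_le_Rintegral _ _ (mu i) h _ 1 (superlevel_borel _ cq) ch h01).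
by move=> x /= qT; rewrite /h le_min lexx andbT le_max; apply/orP; left; lra.
Qed.

(** The excess is unbounded, so the bound passes to the limit for its truncations at [n] and then by
    monotone convergence. *)
Lemma weak_limit_excess q (S eta : R) : continuous q ->
  (\forall i \near F, (\int[mu i]_x (Num.max (q x - S)%R 0%R)%:E <= eta%:E)%E) ->
  (\int[M]_x (Num.max (q x - S)%R 0%R)%:E <= eta%:E)%E.
Proof.
move=> cq near_eta; pose g x := Num.max (q x - S) 0.
have cg : continuous g by exact: continuous_excess.
have g0 x : 0 <= g x by rewrite le_max lexx orbT.
pose gn n x := Num.min (g x) n%:R.
have cgn n : continuous (gn n).
  by move=> x; apply: (@continuous_min R X g (fun=> n%:R)); [exact: cg|exact: cvg_cst].
have gn0 n x : 0 <= gn n x by rewrite le_min g0/=.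
have gnn n x : `|gn n x| <= n%:R by rewrite ger0_norm// ge_min lexx orbT.
have int_gn n (nu : {finite_measure set (borel X) -> \bar R}) :
    (\int[nu]_x (gn n x)%:E)%E = (\int[nu]_x (gn n : borel X -> R) x)%:E.
  rewrite fineK//; apply: integrable_fin_num => //.
  exact: (bounded_integrable nu (cgn n) (gnn n)).
have limgn n : (\int[M]_x (gn n x)%:E <= eta%:E)%E.
  rewrite int_gn lee_fin.
  apply: (cvgr_to_le (hw (cgn n) (ex_intro _ n%:R (gnn n)))).
  apply: filterS near_eta => i eta_i; rewrite -lee_fin -int_gn.
  by apply: le_trans eta_i; apply: le_integral_pos => x; rewrite lee_fin// ge_min lexx.
rewrite [leLHS](_ : _ = (\int[M]_x limn (fun n => (gn n x)%:E))%E); last first.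
  apply: eq_integral => x _; apply/esym/cvg_lim => //; apply: cvg_near_cst.
  exists (Num.bound (g x)) => // n /= gn_; rewrite /gn (min_idPl _)//.
  by apply: le_trans (ltW (archi_boundP (g0 x))) _; rewrite ler_nat.
rewrite monotone_convergence//.
- apply: lime_le; last by apply: nearW => n; exact: limgn.
  apply: ereal_nondecreasing_is_cvgn => n k nk; apply: le_integral_pos => x.
    by rewrite lee_fin.
  by rewrite lee_fin /gn le_min ge_min lexx/= ge_min ler_nat nk orbT.
- by move=> n; apply/measurable_EFinP; exact: continuous_borel.
- by move=> n x _; rewrite lee_fin.
- move=> x _ n k nk; rewrite lee_fin /gn le_min ge_min lexx/= ge_min ler_nat nk orbT//.
Qed.

End WeakLimit.

Lemma Rintegral_mass1 d (T : measurableType d) (R : realType)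
    (m : {measure set T -> \bar R}) (a : R) : m setT = 1%E -> \int[m]_x a = a.
Proof.
move=> m1; rewrite -[RHS]mulr1 -[X in _ = _ * X]/(fine 1%E) -m1.
exact: Rintegral_cst.
Qed.

(** * Convergence uniform over Lipschitz functions *)

Section Kantorovich.
Context (R : realType) (X : tvsType R).

Lemma lipschitz_integrable (nu : {finite_measure set (borel X) -> \bar R})
    (q f : X -> R) (x0 : X) : seminorm q -> continuous q ->
  nu.-integrable setT (EFin \o (q : borel X -> R)) ->
  (forall x y, `|f x - f y| <= q (x - y)) ->
  nu.-integrable setT (EFin \o (f : borel X -> R)).
Proof.
move=> sq cq iq fq.
have := integrableD measurableT (finite_measure_integrable_cst nu (`|f x0| + q x0) measurableT) iq.
apply: le_integrable => //.
  by apply/measurable_EFinP; apply: continuous_borel; exact: lipschitz_continuous fq.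
move=> x _ /=; rewrite lee_fin.
have q0 := seminorm_ge0 x sq; have q00 := seminorm_ge0 x0 sq.
rewrite (ger0_norm (addr_ge0 (addr_ge0 (normr_ge0 _) q00) q0)).
have := ler_normD (f x - f x0) (f x0); rewrite subrK.
have := fq x x0; have := ler_seminormB x x0 sq; lra.
Qed.

(** Replaces [f] by the interpolation of its values at the centers [k]. The error bound does not
    involve [f], so only finitely many numbers [f k] remain to be controlled. *)
Lemma kantorovich_estimate (nu : {finite_measure set (borel X) -> \bar R})
    (q f : X -> R) (x0 : X) (S e : R) (s : seq X) (phi : X -> X -> R) :
  nu setT = 1%E -> seminorm q -> continuous q ->
  nu.-integrable setT (EFin \o (q : borel X -> R)) ->
  (forall k, continuous (phi k)) -> (forall k x, 0 <= phi k x <= 2) ->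
  (forall x, \sum_(k <- s) phi k x <= 1) ->
  (forall k x, phi k x * q (x - k) <= phi k x * e) -> 0 <= e ->
  (forall x y, `|f x - f y| <= q (x - y)) -> f x0 = 0 ->
  `|\int[nu]_x (f : borel X -> R) x -
     \sum_(k <- s) f k * \int[nu]_x (phi k : borel X -> R) x| <=
  e + (S + q x0) * (1 - \sum_(k <- s) \int[nu]_x (phi k : borel X -> R) x) +
  \int[nu]_x ((fun x => Num.max (q x - S) 0) : borel X -> R) x.
Proof.
move=> nu1 sq cq iq cphi phi02 phi1 phiq e0 fq fx0.
have iphi k : nu.-integrable setT (EFin \o (phi k : borel X -> R)).
  apply: (bounded_integrable nu (cphi k) (M := 2)) => x.
  by have /andP[p0 p2] := phi02 k x; rewrite ger0_norm.
have [iPhi intPhi] := Rintegral_sum_seq s iphi.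
have ifphi k : nu.-integrable setT (EFin \o ((fun x => f k * phi k x) : borel X -> R)).
  by have := integrableZl measurableT (f k) (iphi k); apply: eq_integrable.
have [iG intG] := Rintegral_sum_seq s ifphi.
have i_f := lipschitz_integrable x0 sq cq iq fq.
have ic (a : R) : nu.-integrable setT (EFin \o (fun _ : borel X => a)).
  exact: (finite_measure_integrable_cst nu a measurableT).
pose ex := (fun x => Num.max (q x - S) 0) : borel X -> R.
have iex : nu.-integrable setT (EFin \o ex).
  have := integrableD measurableT (ic `|S|) iq; apply: le_integrable => //.
    by apply/measurable_EFinP; apply: continuous_borel; exact: continuous_excess.
  move=> x _ /=; rewrite lee_fin.
  have q0 := seminorm_ge0 x sq.
  rewrite (ger0_norm (addr_ge0 (normr_ge0 S) q0)) ger0_norm ?le_max ?lexx ?orbT//.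
  by rewrite ge_max addr_ge0// andbT; have := ler_norm (- S); rewrite normrN; lra.
pose Phi x := \sum_(k <- s) phi k x.
pose G x := \sum_(k <- s) f k * phi k x.
have i1 : nu.-integrable setT (EFin \o ((fun x => 1 - Phi x) : borel X -> R)).
  by have := integrableB measurableT (ic 1) iPhi; apply: eq_integrable.
have i2 : nu.-integrable setT (EFin \o ((fun x => (S + q x0) * (1 - Phi x)) : borel X -> R)).
  by have := integrableZl measurableT (S + q x0) i1; apply: eq_integrable.
have i3 : nu.-integrable setT (EFin \o ((fun x => e + (S + q x0) * (1 - Phi x)) : borel X -> R)).
  by have := integrableD measurableT (ic e) i2; apply: eq_integrable.
have i4 : nu.-integrable setT
    (EFin \o ((fun x => e + (S + q x0) * (1 - Phi x) + ex x) : borel X -> R)).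
  by have := integrableD measurableT i3 iex; apply: eq_integrable.
have iB : nu.-integrable setT (EFin \o ((fun x => f x - G x) : borel X -> R)).
  by have := integrableB measurableT i_f iG; apply: eq_integrable.
have <- : \sum_(k <- s) \int[nu]_x (f k * phi k x) =
    \sum_(k <- s) f k * \int[nu]_x (phi k : borel X -> R) x.
  by apply: eq_bigr => k _; rewrite RintegralZl.
rewrite -intG -RintegralB//.
apply: le_trans (le_normr_Rintegral _ iB) _ => //.
have -> : e + (S + q x0) * (1 - \sum_(k <- s) \int[nu]_x (phi k : borel X -> R) x) +
    \int[nu]_x ex x = \int[nu]_x (e + (S + q x0) * (1 - Phi x) + ex x).
  by rewrite RintegralD// RintegralD// Rintegral_mass1// RintegralZl// RintegralB// Rintegral_mass1// intPhi.
apply: le_Rintegral => //.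
  by have := integrable_abse iB; apply: eq_integrable.
move=> x _.
(* The first term lives where the partition does not sum to 1, the second compares [f] with its
   value at a nearby center. *)
have decomp : f x - G x = (1 - Phi x) * f x + \sum_(k <- s) phi k x * (f x - f k).
  under eq_bigr do rewrite mulrBr.
  rewrite sumrB -mulr_suml -/(Phi x) /G.
  under [X in _ = _ + (_ - X)]eq_bigr do rewrite mulrC.
  by ring.
rewrite decomp; apply: le_trans (ler_normD _ _) _.
have Phi0 : 0 <= Phi x by apply: sumr_ge0 => k _; have /andP[] := phi02 k x.
have Phi1 : Phi x <= 1 by exact: phi1.
have sume : `|\sum_(k <- s) phi k x * (f x - f k)| <= e.
  apply: le_trans (ler_norm_sum _ _ _) _.
  apply: (@le_trans _ _ (\sum_(k <- s) phi k x * e)).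
    apply: ler_sum => k _; have /andP[p0 _] := phi02 k x.
    rewrite normrM (ger0_norm p0); apply: le_trans (phiq k x).
    by apply: ler_wpM2l => //; exact: fq.
  by rewrite -mulr_suml ler_piMl.
have fS : `|f x| <= S + q x0 + ex x.
  have := fq x x0; rewrite fx0 subr0; have := ler_seminormB x x0 sq.
  have : q x - S <= ex x by rewrite /ex le_max lexx.
  lra.
have ex0 : 0 <= ex x by rewrite /ex le_max lexx orbT.
have t0 : 0 <= 1 - Phi x by rewrite subr_ge0.
rewrite normrM (ger0_norm t0).
have := ler_wpM2l t0 fS; rewrite mulrDr.
have : (1 - Phi x) * ex x <= ex x by rewrite ler_piMl// gerBl.
rewrite (mulrC (S + q x0)); lra.
Qed.

Context (I : Type) (F : set_system I) {FF : ProperFilter F}.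
Variables (mu : I -> probability (borel X) R).
Variable M : {finite_measure set (borel X) -> \bar R}.
Hypothesis hw : forall f : X -> R, continuous f -> (exists C : R, forall x, `|f x| <= C) ->
  (\int[mu i]_x (f : borel X -> R) x) @[i --> F] --> \int[M]_x (f : borel X -> R) x.
Hypothesis hX : hausdorff_space X.
Hypothesis tight : forall e : R, 0 < e -> exists2 K : set X, compact K &
  (M (~` K : set (borel X)) < e%:E)%E.

Lemma weak_limit_kantorovich (q : X -> R) (x0 : X) (e : R) :
  seminorm q -> continuous q ->
  (forall i, (mu i).-integrable setT (EFin \o (q : borel X -> R))) ->
  M.-integrable setT (EFin \o (q : borel X -> R)) ->
  (forall eta : R, 0 < eta -> exists S : R, \forall i \near F,
    (\int[mu i]_x (Num.max (q x - S)%R 0%R)%:E <= eta%:E)%E) ->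
  0 < e ->
  \forall i \near F, forall f : X -> R,
    (forall x y, `|f x - f y| <= q (x - y)) -> f x0 = 0 ->
    `|\int[mu i]_x (f : borel X -> R) x - \int[M]_x (f : borel X -> R) x| <= e.
Proof.
move=> sq cq imu iM ui e0.
(* Seven shares: three for the interpolation error under [mu i] (oscillation, mass off [K], excess),
   three under [M], and one for the finite sums. *)
pose d := e / 7; have d0 : 0 < d by rewrite divr_gt0.
have [S near_S] := ui d d0.
have MS : (\int[M]_x (Num.max (q x - S)%R 0%R)%:E <= d%:E)%E.
  exact: (@weak_limit_excess _ _ _ _ FF _ _ hw _ _ _ cq near_S).
pose T := `|S + q x0| + 1; have T0 : 0 < T by rewrite ltr_wpDl.
have dT0 : 0 < d / T by rewrite divr_gt0.
have [K cK MK] := tight dT0.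
have d20 : 0 < d / 2 by rewrite divr_gt0.
have [s [phi [cphi phi02 phi1 phiK phiq]]] := partition_of_unity sq cq cK d20.
have phiqd k x : phi k x * q (x - k) <= phi k x * d.
  by apply: le_trans (phiq k x) _; rewrite (_ : 2 * (d / 2) = d)//; lra.
have cphib k : exists C : R, forall x, `|phi k x| <= C.
  by exists 2 => x; have /andP[p0 p2] := phi02 k x; rewrite ger0_norm.
have mass1 (nu : {finite_measure set (borel X) -> \bar R}) : nu setT = 1%E ->
    1 - \sum_(k <- s) \int[nu]_x (phi k : borel X -> R) x =
    \int[nu]_x ((fun x => 1 - \sum_(k <- s) phi k x) : borel X -> R) x.
  move=> nu1; have iphi k : nu.-integrable setT (EFin \o (phi k : borel X -> R)).
    by have [C phiC] := cphib k; exact: (bounded_integrable nu (cphi k) phiC).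
  have [iPhi <-] := Rintegral_sum_seq s iphi.
  rewrite RintegralB//; last exact: (finite_measure_integrable_cst nu 1 measurableT).
  by rewrite Rintegral_mass1.
have Phi0 x : 0 <= \sum_(k <- s) phi k x.
  by apply: sumr_ge0 => k _; have /andP[] := phi02 k x.
have M1 : M setT = 1%E by exact: (@weak_limit_mass _ _ _ _ FF _ _ hw).
have mu1 i : mu i setT = 1%E by exact: probability_setT.
have remM : 1 - \sum_(k <- s) \int[M]_x (phi k : borel X -> R) x < d / T.
  rewrite (mass1 _ M1).
  have mK : measurable (~` K : set (borel X)) by apply: measurableC; exact: compact_borel.
  apply: le_lt_trans (@Rintegral_le_measure _ _ M _ _ mK _ _ _) _.
  - move=> x; apply: cvgB; first exact: cvg_cst.
    exact: continuous_sum_seq.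
  - by move=> x; rewrite subr_ge0 phi1 gerBl Phi0.
  - by move=> x /contrapT/phiK ->; rewrite subrr.
  - have fK := fin_num_measure M _ mK.
    by move: MK; rewrite -(fineK fK) lte_fin.
have cvgphi k : (\int[mu i]_x (phi k : borel X -> R) x) @[i --> F] -->
    \int[M]_x (phi k : borel X -> R) x by exact: hw.
(* No compact set is available for [mu i]; its mass off [K] is seen only through the continuous
   functions [phi k]. *)
have near_rem : \forall i \near F,
    1 - \sum_(k <- s) \int[mu i]_x (phi k : borel X -> R) x < d / T.
  apply: (@cvgr_lt R I F _ (fun i => 1 - \sum_(k <- s) \int[mu i]_x (phi k : borel X -> R) x)
    _ _ _ remM).
  by apply: cvgB; [exact: cvg_cst|exact: cvg_sum_seq].
(* Since [f x0 = 0] gives [|f k| <= q (k - x0)], this one sum serves all [f] at once. *)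
have near_sum : \forall i \near F, \sum_(k <- s) q (k - x0) *
    `|\int[mu i]_x (phi k : borel X -> R) x - \int[M]_x (phi k : borel X -> R) x| < d.
  have cvg0 : (\sum_(k <- s) q (k - x0) * `|\int[mu i]_x (phi k : borel X -> R) x -
      \int[M]_x (phi k : borel X -> R) x|) @[i --> F] --> (0 : R).
    rewrite [X in _ --> X](_ : 0 = \sum_(k <- s) q (k - x0) * `|(0 : R)|); last first.
      by rewrite big1// => k _; rewrite normr0 mulr0.
    apply: cvg_sum_seq => k; apply: cvgM; first exact: cvg_cst.
    apply: cvg_norm; rewrite -[X in _ --> X](subrr (\int[M]_x (phi k : borel X -> R) x)).
    by apply: cvgB; [exact: cvgphi|exact: cvg_cst].
  exact: (@cvgr_lt R I F _ _ _ cvg0 _ d0).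
have small (nu : {finite_measure set (borel X) -> \bar R}) (f : X -> R) :
    nu setT = 1%E -> nu.-integrable setT (EFin \o (q : borel X -> R)) ->
    1 - \sum_(k <- s) \int[nu]_x (phi k : borel X -> R) x < d / T ->
    (\int[nu]_x (Num.max (q x - S)%R 0%R)%:E <= d%:E)%E ->
    (forall x y, `|f x - f y| <= q (x - y)) -> f x0 = 0 ->
    `|\int[nu]_x (f : borel X -> R) x -
      \sum_(k <- s) f k * \int[nu]_x (phi k : borel X -> R) x| <= 3 * d.
  move=> nu1 iq rem nuS fq fx0.
  apply: le_trans (kantorovich_estimate S nu1 sq cq iq cphi phi02 phi1 phiqd (ltW d0) fq fx0) _.
  have exS : \int[nu]_x ((fun x => Num.max (q x - S) 0) : borel X -> R) x <= d.
    rewrite -lee_fin /Rintegral fineK//.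
    rewrite ge0_fin_numE; first exact: le_lt_trans nuS (ltry _).
    by apply: integral_ge0 => x _; rewrite lee_fin le_max lexx orbT.
  have rem0 : 0 <= 1 - \sum_(k <- s) \int[nu]_x (phi k : borel X -> R) x.
    by rewrite (mass1 _ nu1); apply: Rintegral_ge0 => x _; rewrite subr_ge0.
  have : (S + q x0) * (1 - \sum_(k <- s) \int[nu]_x (phi k : borel X -> R) x) <= d.
    apply: (@le_trans _ _ (T * (d / T))); last by rewrite mulrC divfK// gt_eqF.
    apply: (@le_trans _ _ (T * (1 - \sum_(k <- s) \int[nu]_x (phi k : borel X -> R) x))).
      by apply: ler_wpM2r => //; rewrite /T; have := ler_norm (S + q x0); lra.
    by rewrite ler_pM2l// ltW.
  lra.
apply: filterS3 near_S near_rem near_sum => i muS rem sum_d f fq fx0.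
have hmu := small (mu i) f (mu1 i) (imu i) rem muS fq fx0.
have hM := small M f M1 iM remM MS fq fx0.
have hs : `|\sum_(k <- s) f k * \int[mu i]_x (phi k : borel X -> R) x -
    \sum_(k <- s) f k * \int[M]_x (phi k : borel X -> R) x| <= d.
  rewrite -sumrB; apply: le_trans (ler_norm_sum _ _ _) _.
  apply: le_trans (ltW sum_d); apply: ler_sum => k _.
  rewrite -mulrBr normrM ler_wpM2r//.
  by have := fq k x0; rewrite fx0 subr0.
have -> : e = 7 * d by rewrite /d; lra.
move: hmu hM hs.
move: (\int[mu i]_x _) (\int[M]_x _) (\sum_(_ <- _) _) (\sum_(_ <- _) _) => a b u w.
rewrite !ler_norml => /andP[? ?] /andP[? ?] /andP[? ?]; apply/andP; split; lra.
Qed.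

End Kantorovich.

(** * The barycenter of the limit *)

Section LimitBarycenter.
Context (R : realType) (X : tvsType R).
Context (I : Type) (F : set_system I) {FF : ProperFilter F}.
Variables (mu : I -> probability (borel X) R).
Variable M : {finite_measure set (borel X) -> \bar R}.
Hypothesis hw : forall f : X -> R, continuous f -> (exists C : R, forall x, `|f x| <= C) ->
  (\int[mu i]_x (f : borel X -> R) x) @[i --> F] --> \int[M]_x (f : borel X -> R) x.
Hypothesis hX : hausdorff_space X.
Hypothesis tight : forall e : R, 0 < e -> exists2 K : set X, compact K &
  (M (~` K : set (borel X)) < e%:E)%E.
Variables (c : I -> R) (v : I -> X) (c1 : R).
Hypothesis mu_stable : forall i, stable_sum (mu i) (c i) (v i).
Hypothesis c_bounds : forall i, 1 < c i <= c1.
Hypothesis c1_lt2 : c1 < 2.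

Lemma strict_sublevel_borel (f : X -> R) (t : R) : continuous f ->
  measurable ([set x | f x < t] : set (borel X)).
Proof.
move=> cf; apply: open_borel.
by apply: (@open_comp _ _ f [set r | r < t]) => [x _|]; [exact: cf|exact: open_lt].
Qed.

(* If [x] and [c x + v] lie in [A] and [A + A] up to a small error, then
   [(2 - c)^-1 v] lies in this compact set up to a small error. *)
Definition barycenter_set (A : set X) : set X :=
  (fun z : ((X * X) * X) * (R^o * R^o) =>
     z.2.1 *: (z.1.1.1 + z.1.1.2 - z.2.2 *: z.1.2)) @`
  ((A `*` A `*` A) `*` (`[0, (2 - c1)^-1]%classic `*` `[1, c1]%classic)).

(** The scale and the factor [(2 - c)^-1] range over segments as independent parameters, so one
    compact set serves all orders. *)
Lemma compact_barycenter_set A : compact A -> compact (barycenter_set A).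
Proof.
move=> cA; apply: continuous_compact; last first.
  apply: compact_setX; first by do 2 apply: compact_setX => //.
  by apply: compact_setX; exact: segment_compact.
apply: continuous_subspaceT => z.
have c_scale (f : ((X * X) * X) * (R^o * R^o) -> R^o) (g : ((X * X) * X) * (R^o * R^o) -> X) :
    {for z, continuous f} -> {for z, continuous g} ->
    {for z, continuous (fun y => f y *: g y)}.
  move=> cf cg; apply: (@continuous_comp _ (R^o * X)%type X (fun y => (f y, g y))
    (fun y => y.1 *: y.2)); last exact: scale_continuous.
  by apply: (@cvg_pair _ _ _ _ (nbhs (f z)) (nbhs (g z))); [exact: cf|exact: cg].
have c_add (f g : ((X * X) * X) * (R^o * R^o) -> X) :
    {for z, continuous f} -> {for z, continuous g} ->
    {for z, continuous (fun y => f y + g y)}.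
  move=> cf cg; apply: (@continuous_comp _ (X * X)%type X (fun y => (f y, g y))
    (fun y => y.1 + y.2)); last exact: add_continuous.
  by apply: (@cvg_pair _ _ _ _ (nbhs (f z)) (nbhs (g z))); [exact: cf|exact: cg].
have c_opp (f : ((X * X) * X) * (R^o * R^o) -> X) :
    {for z, continuous f} -> {for z, continuous (fun y => - f y)}.
  by move=> cf; apply: (@continuous_comp _ X X f -%R) => //; exact: opp_continuous.
have cfst (T1 T2 S : topologicalType) (g : S -> T1 * T2) y :
    {for y, continuous g} -> {for y, continuous (fun u => (g u).1)}.
  move=> cg; apply: (@continuous_comp S (T1 * T2)%type T1 g fst) => //.
  exact: cvg_fst.
have csnd (T1 T2 S : topologicalType) (g : S -> T1 * T2) y :
    {for y, continuous g} -> {for y, continuous (fun u => (g u).2)}.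
  move=> cg; apply: (@continuous_comp S (T1 * T2)%type T2 g snd) => //.
  exact: cvg_snd.
have cid : {for z, continuous (fun y : ((X * X) * X) * (R^o * R^o) => y)} by exact: cvg_id.
have z1 := cfst _ _ _ _ _ cid; have z2 := csnd _ _ _ _ _ cid.
have z11 := cfst _ _ _ _ _ z1.
apply: (@c_scale _ _); first exact: cfst z2.
apply: (@c_add _ _).
  by apply: (@c_add _ _); [exact: cfst z11|exact: csnd z11].
by apply: (@c_opp _); apply: (@c_scale _ _); [exact: csnd z2|exact: csnd z1].
Qed.

Let t1 := (2 - c1)^-1.
Let b i := (2 - c i)^-1 *: v i.

(** The laws may not charge [A] itself, so [A] is thickened to a [q]-neighbourhood of mass at least
    3/4; the bound 1/8 for [M] leaves room for a limit below 1/4. *)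
Lemma near_barycenter_set (A : set X) (q : X -> R) (r : R) : compact A ->
  (M (~` A : set (borel X)) < (1 / 8)%:E)%E -> seminorm q -> continuous q -> 0 < r ->
  \forall i \near F, exists2 z, barycenter_set A z & q (b i - z) <= r.
Proof.
move=> cA MA sq cq r0.
have t10 : 0 < t1 by rewrite invr_gt0 subr_gt0.
(* The errors are [2 d] for [c x + v] and at most [2 d] for [c x]; the factor [(2 - c)^-1 <= t1]
   turns their sum into [r]. *)
pose d := r / (4 * t1); have d0 : 0 < d by rewrite divr_gt0// mulr_gt0.
have M1 : M setT = 1%E by exact: (@weak_limit_mass _ _ _ _ FF _ _ hw).
have A0 : A !=set0.
  apply/set0P/eqP => A0; move: MA; rewrite A0 setC0 M1 lte_fin; lra.
have mAC : measurable (~` A : set (borel X)) by apply: measurableC; exact: compact_borel.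
pose dA := seminorm_dist q A.
have cdA : continuous dA by exact: seminorm_dist_continuous.
have dA0 x : 0 <= dA x by apply: seminorm_dist_ge => // a _; exact: seminorm_ge0.
pose h x := Num.min (dA x / d) 1.
have ch : continuous h.
  move=> x; apply: (@continuous_min R X (fun x => dA x / d) (fun=> 1)); last exact: cvg_cst.
  by apply: cvgM; [exact: cdA|exact: cvg_cst].
have h01 x : 0 <= h x <= 1 by rewrite /h le_min ler01 divr_ge0 ?(ltW d0)//= ge_min lexx orbT.
have hM : \int[M]_x (h : borel X -> R) x < 1 / 4.
  have := @Rintegral_le_measure _ _ M h _ mAC ch h01.
  move=> /(_ _)/wrap[].
    by move=> x /contrapT Ax; rewrite /h /dA seminorm_dist_mem// mul0r (min_idPl _).
  have fA := fin_num_measure M _ mAC.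
  by move: MA; rewrite -(fineK fA) lte_fin /=; lra.
have hb : exists C : R, forall x, `|h x| <= C.
  by exists 1 => x; have /andP[h0 h1] := h01 x; rewrite ger0_norm.
have near_h : \forall i \near F, \int[mu i]_x (h : borel X -> R) x < 1 / 4.
  exact: (@cvgr_lt R I F _ (fun i => \int[mu i]_x (h : borel X -> R) x) _ (hw ch hb) _ hM).
apply: filterS near_h => i hi.
have /andP[ci1 cic1] := c_bounds i; have ci0 : 0 < c i by lra.
pose G1 : set (borel X) := [set x | dA x < d].
have mG1 : measurable G1 by exact: strict_sublevel_borel.
have muG1 : ((3 / 4)%:E <= mu i G1)%E.
  have mG1C := measurableC mG1.
  have : fine (mu i (~` G1)) <= 1 / 4.
    apply: le_trans (ltW hi).
    apply: (@measure_le_Rintegral _ _ (mu i) h _ 1 mG1C ch h01) => x.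
    move=> /negP; rewrite -leNgt => dx.
    by rewrite /h le_min lexx andbT ler_pdivlMr// mul1r.
  have fG := fin_num_measure (mu i) _ mG1.
  rewrite probability_setC// -(fineK fG) -EFinB lee_fin /=; lra.
pose A2 := [set x | exists a b, [/\ A a, A b & x = a + b]].
have A20 : A2 !=set0 by have [a Aa] := A0; exists (a + a), a, a.
pose G2 : set (borel X) := [set x | seminorm_dist q A2 x < 2 * d].
have mG2 : measurable G2.
  by apply: strict_sublevel_borel; exact: seminorm_dist_continuous.
have G12 (x y : X) : G1 x -> G1 y -> G2 (x + y).
  move=> /(seminorm_dist_lt sq A0)[a Aa xa] /(seminorm_dist_lt sq A0)[a' Aa' ya'].
  have A2aa' : A2 (a + a') by exists a, a'.
  apply: le_lt_trans (seminorm_dist_le _ sq A2aa') _.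
  rewrite opprD addrACA; apply: le_lt_trans (sq.1 _ _) _; lra.
have [x [/(seminorm_dist_lt sq A0)[a0 Aa0 xa0]]] := stable_sum_meets (mu_stable i) mG1 mG2 G12 muG1.
move=> /(seminorm_dist_lt sq A20)[_ [a [a' [Aa Aa' ->]]] xa].
have ti0 : 0 < 2 - c i by have := c1_lt2; lra.
exists ((2 - c i)^-1 *: (a + a' - c i *: a0)).
  exists (((a, a'), a0), ((2 - c i)^-1, c i)) => //=; split => //; split => /=.
    rewrite in_itv/= invr_ge0 (ltW ti0)/= lef_pV2 ?posrE ?subr_gt0//; have := c1_lt2; lra.
  by rewrite in_itv/= (ltW ci1).
rewrite /b -scalerBr sq.2 gtr0_norm ?invr_gt0//.
have -> : v i - (a + a' - c i *: a0) = (c i *: x + v i - (a + a')) - c i *: (x - a0).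
  have shiftE (u w s z : X) : w - (s - z) = (u + w - s) - (u - z).
    by rewrite !opprB [z - u]addrC addrACA [u + w - u]addrAC subrr add0r [- s + z]addrC.
  by rewrite scalerBr; exact: shiftE.
have : q ((c i *: x + v i - (a + a')) - c i *: (x - a0)) <= 4 * d.
  apply: le_trans (ler_seminormB _ _ sq) _; rewrite (sq.2 (c i)) gtr0_norm//.
  have : c i * q (x - a0) <= 2 * d.
    by rewrite ler_pM ?(ltW ci0) ?(ltW xa0) ?seminorm_ge0//; lra.
  lra.
move: (q _) (seminorm_ge0 (c i *: x + v i - (a + a') - c i *: (x - a0)) sq) => y y0 yd.
apply: (@le_trans _ _ (t1 * (4 * d))).
  by rewrite ler_pM ?invr_ge0 ?(ltW ti0)// lef_pV2 ?posrE ?subr_gt0//; have := c1_lt2; lra.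
by rewrite /d (_ : t1 * (4 * (r / (4 * t1))) = r)//; field; rewrite gt_eqF.
Qed.

Hypothesis mu_integrable : forall q : X -> R, seminorm q -> continuous q ->
  forall i, (mu i).-integrable setT (EFin \o (q : borel X -> R)).
Hypothesis mu_kantorovich : forall (q : X -> R) (r : R), seminorm q -> continuous q ->
  0 < r -> \forall i \near F, forall f : {linear X -> R^o}, (forall x, `|f x| <= q x) ->
    `|\int[mu i]_x (f : borel X -> R) x - \int[M]_x (f : borel X -> R) x| <= r.

Lemma stable_barycenter i (f : {linear X -> R^o}) : continuous (f : X -> R) ->
  (mu i).-integrable setT (EFin \o (f : borel X -> R)) /\
  f (b i) = \int[mu i]_x (f : borel X -> R) x.
Proof.
move=> cf; have fi : (mu i).-integrable setT (EFin \o (f : borel X -> R)).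
  have cnf : continuous (fun x => `|f x|) by move=> x; apply: cvg_norm; exact: cf.
  have := mu_integrable (seminorm_linear f) cnf i; apply: le_integrable => //.
    by apply/measurable_EFinP; exact: continuous_borel.
  by move=> x _ /=; rewrite normr_id.
split => //; rewrite /b linearZ /= (stable_sum_mean (mu_stable i) cf fi).
have /andP[ci1 cic1] := c_bounds i.
have ti0 : 0 < 2 - c i by have := c1_lt2; lra.
by apply: mulKf; rewrite gt_eqF.
Qed.

(** The sets [E (q, r)] of approximate barycenters in the compact set form a filter base: each
    contains a point close to some [b i], whose values are integrals close to those of [M]. A
    cluster point solves all equations exactly. *)
Lemma weak_limit_barycenter : exists z : X, forall f : {linear X -> R^o},
  continuous (f : X -> R) -> f z = \int[M]_x (f : borel X -> R) x.
Proof.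
have [|A cA MA] := tight (e := 1 / 8); first by lra.
have cC := compact_barycenter_set cA.
pose E (w : (X -> R) * R) := [set z | barycenter_set A z /\
  forall f : {linear X -> R^o}, (forall x, `|f x| <= w.1 x) ->
    `|f z - \int[M]_x (f : borel X -> R) x| <= w.2].
pose D : set ((X -> R) * R) := [set w | [/\ seminorm w.1, continuous w.1 & 0 < w.2]].
pose G := filter_from D E.
have E0 w : D w -> E w !=set0.
  case: w => q r [/= sq cq r0]; have r20 : 0 < r / 2 by rewrite divr_gt0.
  have near1 := near_barycenter_set cA MA sq cq r20.
  have near2 := mu_kantorovich sq cq r20.
  have [i [[z Cz qz] hi]] := filter_ex (filterI near1 near2).
  exists z; split => //= f fq.
  have cf := seminorm_bounded_continuous sq cq fq.
  have [_ fb] := stable_barycenter i cf.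
  have := hi f fq; rewrite -fb.
  have : `|f (b i) - f z| <= r / 2 by rewrite -linearB; apply: le_trans (fq _) _.
  rewrite !ler_norml => /andP[? ?] /andP[? ?]; apply/andP; split; lra.
have q00 : seminorm (fun _ : X => 0 : R) by split=> *; rewrite ?addr0 ?mulr0.
have PG : ProperFilter G.
  apply: filter_from_proper; last exact: E0.
  apply: filter_from_filter.
    by exists (fun=> 0, 1); split => //= x; exact: cvg_cst.
  move=> [q r] [q' r'] [/= sq cq r0] [/= sq' cq' r0'].
  exists (q \+ q', Num.min r r').
    split => /=; [exact: seminorm_add| |by rewrite lt_min r0 r0'].
    by move=> x; apply: cvgD; [exact: cq|exact: cq'].
  move=> z [Cz zf]; split; split => //= f fq.
    apply: le_trans (zf f _) _ => /=; last by rewrite ge_min lexx.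
    by move=> x; apply: le_trans (fq x) _; rewrite lerDl seminorm_ge0.
  apply: le_trans (zf f _) _ => /=; last by rewrite ge_min lexx orbT.
  by move=> x; apply: le_trans (fq x) _; rewrite lerDr seminorm_ge0.
have GC : G (barycenter_set A).
  exists (fun=> 0, 1); last by move=> z [].
  by split => //= x; exact: cvg_cst.
have [z [_ clz]] := cC G PG GC.
exists z => f cf; apply/eqP; rewrite -subr_eq0 -normr_eq0 eq_le normr_ge0 andbT.
apply/ler_addgt0Pr => e e0; rewrite add0r.
have e20 : 0 < e / 2 by rewrite divr_gt0.
have cnf : continuous (fun x => `|f x|) by move=> x; apply: cvg_norm; exact: cf.
(* For a single functional the seminorm [|f|] is enough; continuity of [f] at [z] absorbs the rest
   of [e]. *)
have GE : G (E (fun x => `|f x|, e / 2)).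
  by exists (fun x => `|f x|, e / 2) => //; split => //=; exact: seminorm_linear.
have nz : nbhs z [set y | `|f z - f y| < e / 2].
  by have /cvgrPdist_lt/(_ _ e20) := cf z.
have [y [[_ /(_ f (fun=> lexx _)) /= fy] /= zy]] := clz _ _ GE nz.
move: fy zy; rewrite ltr_norml !ler_norml => /andP[? ?] /andP[? ?]; apply/andP; split; lra.
Qed.

End LimitBarycenter.

(** * The Kantorovich space *)

Section KantorovichSpace.
Context (R : realType) (X : tvsType R) (x0 : X).
Implicit Types (nu : {charge set (borel X) -> \bar R}) (q f : X -> R).

Lemma kantorovich_cvg (T : Type) (F : set_system T) (nu : T -> kantorovich_space x0)
    (nu0 : kantorovich_space x0) : Filter F ->
  (forall U, kantorovich_subbase U -> U nu0 -> F (nu @^-1` U)) -> nu @ F --> nu0.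
Proof.
move=> FF nuU A [B [[D sD BE] Bnu0 BA]].
move: Bnu0; rewrite -BE => -[V DV Vnu0].
have [E sE VE] := sD V DV.
have : F (nu @^-1` V).
  rewrite -VE preimage_bigcap; apply: filter_bigI => U UE.
  apply: nuU; first by move: sE => /= /(_ _ UE)/set_mem.
  by move: Vnu0; rewrite -VE; apply.
by apply: filterS => t Vt; apply: BA; rewrite -BE; exists V.
Qed.

(** The bound is uniform in [f], so the [sup] in [kantorovich_norm] is a true supremum and not its
    default value. *)
Lemma radon1_lipschitz nu q : radon1 nu -> seminorm q -> continuous q ->
  exists C : R, forall f, (forall x y, `|f x - f y| <= q (x - y)) -> f x0 = 0 ->
    (abs_charge nu).-integrable setT (EFin \o (f : borel X -> R)) /\
    `|cintegral nu (f : borel X -> R)| <= C.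
Proof.
move=> [_ nu1] sq cq; pose g : borel X -> R := fun x => q x0 + q x.
have ig : (abs_charge nu).-integrable setT (EFin \o g).
  have ic : (abs_charge nu).-integrable setT (EFin \o (fun _ : borel X => q x0)).
    apply: (@measurable_bounded_integrable _ _ _ (charge_variation (hahn_posnegP nu))) => //.
      by rewrite ltey_eq /charge_variation fin_numD !fin_num_measure.
    by exists `|q x0|; split; [exact: num_real|move=> N qN x _; exact: ltW].
  have := integrableD measurableT ic (nu1 q sq cq).
  by apply: eq_integrable.
exists (fine (\int[abs_charge nu]_x (g x)%:E)%E) => f fq fx0.
apply: ler_abs_cintegral => //.
  by apply: continuous_borel; exact: lipschitz_continuous fq.
move=> x; have := fq x x0; rewrite fx0 subr0 => /le_trans; apply.
by rewrite /g [leRHS]addrC; exact: ler_seminormB.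
Qed.

(** Subbasic balls are centered at arbitrary [lam], so convergence requires comparing distances to
    [lam]; the mass terms agree because the total masses do. *)
Lemma kantorovich_norm_le nu nu' lam q (d : R) : radon1 nu -> radon1 nu' -> radon1 lam ->
  seminorm q -> continuous q -> nu setT = nu' setT ->
  (forall f, (forall x y, `|f x - f y| <= q (x - y)) -> f x0 = 0 ->
    cintegral nu (f : borel X -> R) <= cintegral nu' (f : borel X -> R) + d) ->
  kantorovich_norm x0 q (cadd nu (copp lam)) <=
  kantorovich_norm x0 q (cadd nu' (copp lam)) + d.
Proof.
move=> rnu rnu' rlam sq cq nuT nud.
have [C hC] := radon1_lipschitz rnu sq cq.
have [C' hC'] := radon1_lipschitz rnu' sq cq.
have [D hD] := radon1_lipschitz rlam sq cq.
rewrite /kantorovich_norm.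
rewrite addrAC; apply: lerD; last first.
  rewrite le_eqVlt; apply/orP; left; apply/eqP; congr (`|fine _|).
  exact: (congr1 (fun r => r - lam setT)%E nuT).
apply: ge_sup.
  exists (cintegral (cadd nu (copp lam)) (cst 0 : borel X -> R)), (cst 0); split => //.
  by move=> x y; rewrite subrr normr0 seminorm_ge0.
move=> _ [f [fq fx0 ->]].
have [i1 b1] := hC f fq fx0; have [i2 b2] := hC' f fq fx0; have [i3 b3] := hD f fq fx0.
rewrite cintegralB//.
apply: (@le_trans _ _ (cintegral nu' (f : borel X -> R) + d - cintegral lam (f : borel X -> R))).
  by rewrite lerD2r; exact: nud.
rewrite addrAC lerD2r -cintegralB//.
apply: ub_le_sup; last by exists f.
exists (C' + D) => _ [g [gq gx0 ->]].
have [j2 e2] := hC' g gq gx0; have [j3 e3] := hD g gq gx0.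
rewrite cintegralB//; apply: le_trans (ler_norm _) _.
by apply: le_trans (ler_normB _ _) _; exact: lerD.
Qed.

End KantorovichSpace.

Lemma net_filter_proper (I : Type) (le : I -> I -> Prop) :
  directed le -> ProperFilter (net_filter le).
Proof.
move=> [[i0] lexx_ le_trans_ led]; apply: filter_from_proper; last by move=> i _; exists i.
apply: filter_from_filter; first by exists i0.
move=> i j _ _; have [k ik jk] := led i j; exists k => // l kl.
by split; [exact: le_trans_ ik kl|exact: le_trans_ jk kl].
Qed.

Theorem theorem4p4 (R : realType) (X : tvsType R) (hX : hausdorff_space X)
    (p1 : R) (hp1 : 1 < p1)
    (I : Type) (le : I -> I -> Prop) (hI : directed le)
    (mu : I -> probability (borel X) R) (p : I -> R)
    (hradon : forall i, radon (mu i))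
    (hp : forall i, p1 < p i)
    (hstable : forall i, stable (p i) (mu i))
    (m : {charge set (borel X) -> \bar R})
    (hm : radon (abs_charge m))
    (hweak : weakly_converges (net_filter le)
               (fun i => charge_of_finite_measure (mu i)) m) :
  (forall x0 : X,
     exists (kmu : forall i, radon1 (charge_of_finite_measure (mu i)))
            (km : radon1 m),
       (fun i => KantorovichSpace x0 (kmu i)) @ net_filter le -->
         KantorovichSpace x0 km) /\
  [/\ forall i, exists b : X, barycenter (charge_of_finite_measure (mu i)) b,
      exists b : X, barycenter m b &
      forall (b : I -> X) (b0 : X),
        (forall i, barycenter (charge_of_finite_measure (mu i)) (b i)) ->
        barycenter m b0 ->
        b @ net_filter le --> b0].

Proof.
set F := net_filter le; have FF : ProperFilter F := net_filter_proper hI.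
pose c1 : R := 2 `^ p1^-1; pose c i : R := 2 `^ (p i)^-1.
have c1b : 1 < c1 < 2.
  (* Any order above [p1] would do, as only the bounds on [c1] are kept. *)
  have [||? ? _ _] := @pow2_inv_bounds R p1 (p1 + 1); [by []|by rewrite ltrDl|exact/andP].
have cb i : 1 < c i <= c1.
  by have [_ _ ? ?] := pow2_inv_bounds hp1 (hp i); apply/andP.
have /choice[v mu_stable] : forall i, exists v, stable_sum (mu i) (c i) v.
  by move=> i; exact: stable_stable_sum (hstable i).
have muE i (f : borel X -> R) : (mu i).-integrable setT (EFin \o f) ->
    cintegral (charge_of_finite_measure (mu i)) f = \int[mu i]_x f x.
  exact: cintegralE.
have mu_bounded i (f : X -> R) : continuous f -> (exists C : R, forall x, `|f x| <= C) ->
    (mu i).-integrable setT (EFin \o (f : borel X -> R)).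
  by move=> cf [C fC]; exact: (bounded_integrable (mu i) cf fC).
(* Nonnegativity on continuous functions passes from the probabilities to the weak limit, so [m]
   coincides with its positive part [M]. *)
have neg0 : forall A : set (borel X), measurable A -> jordan_neg (hahn_posnegP m) A = 0%E.
  apply: radon_jordan_neg_eq0 => // f cf f01.
  have fb : exists C : R, forall x, `|f x| <= C.
    by exists 1 => x; have /andP[f0 f1] := f01 x; rewrite ger0_norm.
  apply: (cvgr_to_ge (hweak f cf fb)); apply: nearW => i.
  rewrite muE; last exact: mu_bounded.
  by apply: Rintegral_ge0 => x _; have /andP[] := f01 x.
pose M : {finite_measure set (borel X) -> \bar R} := jordan_pos (hahn_posnegP m).
have mM (A : set (borel X)) : measurable A -> m A = M A.
  move=> mA; rewrite (jordan_decomp (hahn_posnegP m) mA) /cadd/= cscaleN1.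
  by have /= -> := neg0 A mA; rewrite sube0.
have hw (f : X -> R) : continuous f -> (exists C : R, forall x, `|f x| <= C) ->
    (\int[mu i]_x (f : borel X -> R) x) @[i --> F] --> \int[M]_x (f : borel X -> R) x.
  move=> cf fb; have := hweak f cf fb.
  rewrite (cintegralE mM); last by have [C fC] := fb; exact: (bounded_integrable M cf fC).
  by under eq_cvg do rewrite muE ?mu_bounded//.
have tight (e : R) : 0 < e -> exists2 K : set X, compact K & (M (~` K : set (borel X)) < e%:E)%E.
  move=> e0; have [K [cK _ mK]] := hm setT e measurableT e0; exists K => //.
  rewrite -(abs_chargeE mM); first by rewrite -setTD.
  by apply: measurableC; exact: compact_borel.
have [dlt dlt0 ui] := stable_sum_uniformly_integrable X c1b.
have mu_integrable (q : X -> R) : seminorm q -> continuous q ->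
    forall i, (mu i).-integrable setT (EFin \o (q : borel X -> R)).
  move=> sq cq i; have [T T0 muT] := superlevel_small (mu i) cq dlt0.
  have [S muS] := ui T 1 T0 ltr01.
  apply: (excess_integrable (S := S) cq) => [x|]; first exact: seminorm_ge0.
  exact: le_lt_trans (muS _ _ _ _ (mu_stable i) (cb i) sq cq muT) (ltry _).
(* Weak convergence supplies one level [T] valid eventually; [S] is then common to these indices. *)
have near_ui (q : X -> R) : seminorm q -> continuous q -> forall eta : R, 0 < eta ->
    exists S : R, \forall i \near F, (\int[mu i]_x (Num.max (q x - S)%R 0%R)%:E <= eta%:E)%E.
  move=> sq cq eta eta0.
  have [T T0 near_T] := @weak_limit_tail _ _ _ _ FF _ _ hw _ _ cq dlt0.
  have [S muS] := ui T eta T0 eta0; exists S.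
  by apply: filterS near_T => i; exact: muS (mu_stable i) (cb i) sq cq.
have M_integrable (q : X -> R) : seminorm q -> continuous q ->
    M.-integrable setT (EFin \o (q : borel X -> R)).
  move=> sq cq; have [S near_S] := near_ui q sq cq 1 ltr01.
  apply: (excess_integrable (S := S) cq) => [x|]; first exact: seminorm_ge0.
  exact: le_lt_trans (@weak_limit_excess _ _ _ _ FF _ _ hw _ _ _ cq near_S) (ltry _).
have kant (q : X -> R) (x0 : X) (e : R) : seminorm q -> continuous q -> 0 < e ->
    \forall i \near F, forall f : X -> R,
      (forall x y, `|f x - f y| <= q (x - y)) -> f x0 = 0 ->
      `|\int[mu i]_x (f : borel X -> R) x - \int[M]_x (f : borel X -> R) x| <= e.
  move=> sq cq e0.
  exact: (@weak_limit_kantorovich _ _ _ _ FF _ _ hw hX tight q x0 e sq cq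
    (mu_integrable q sq cq) (M_integrable q sq cq) (near_ui q sq cq) e0).
have kant_lin (q : X -> R) (r : R) : seminorm q -> continuous q -> 0 < r ->
    \forall i \near F, forall f : {linear X -> R^o}, (forall x, `|f x| <= q x) ->
      `|\int[mu i]_x (f : borel X -> R) x - \int[M]_x (f : borel X -> R) x| <= r.
  move=> sq cq r0; apply: filterS (kant q 0 r sq cq r0) => i hi f fq.
  by apply: hi; [move=> x y; rewrite -linearB; exact: fq|exact: linear0].
have M_linear (f : {linear X -> R^o}) : continuous (f : X -> R) ->
    M.-integrable setT (EFin \o (f : borel X -> R)).
  move=> cf; have cnf : continuous (fun x => `|f x|) by move=> x; apply: cvg_norm; exact: cf.
  have := M_integrable _ (seminorm_linear f) cnf; apply: le_integrable => //.
    by apply/measurable_EFinP; exact: continuous_borel.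
  by move=> x _ /=; rewrite normr_id.
have mu_lin i (f : {linear X -> R^o}) (cf : continuous (f : X -> R)) :=
  @stable_barycenter _ _ _ _ _ _ _ mu_stable cb (andP c1b).2 mu_integrable i f cf.
split.
  move=> x0.
  have kmu i : radon1 (charge_of_finite_measure (mu i)).
    split=> [B e mB e0|q sq cq]; last first.
      by apply/(integrable_abs_charge (m := mu i)) => //; exact: mu_integrable.
    have [K [cK KB mK]] := hradon i B e mB e0; exists K; split => //.
    rewrite (abs_chargeE (m := mu i))//.
    by apply: measurableD => //; exact: compact_borel.
  have km : radon1 m.
    by split => // q sq cq; apply/(integrable_abs_charge mM); exact: M_integrable.
  exists kmu, km; apply: kantorovich_cvg => _ [q [lam [e [sq cq e0 ->]]]].
  rewrite /kantorovich_ball /= => normm.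
  (* Half of the room left between the limit and the boundary of the ball. *)
  pose d := (e - kantorovich_norm x0 q (cadd m (copp (kmeasure lam)))) / 2.
  have d0 : 0 < d by rewrite divr_gt0 ?subr_gt0.
  apply: filterS (kant q x0 d sq cq d0) => i hi /=.
  apply: (@le_lt_trans _ _ (kantorovich_norm x0 q (cadd m (copp (kmeasure lam))) + d)).
    apply: kantorovich_norm_le => //; first exact: kmeasureP.
      rewrite mM//; transitivity (1%E : \bar R); first exact: probability_setT.
      by apply/esym; exact: (@weak_limit_mass _ _ _ _ FF _ _ hw).
    move=> f fq fx0.
    have imu := lipschitz_integrable x0 sq cq (mu_integrable q sq cq i) fq.
    have iM := lipschitz_integrable x0 sq cq (M_integrable q sq cq) fq.
    rewrite (muE _ _ imu) (cintegralE mM iM).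
    by have := hi f fq fx0; rewrite ler_norml => /andP[_]; lra.
  by rewrite /d; lra.
split.
- move=> i; exists ((2 - c i)^-1 *: v i) => f cf; have [fi fb] := mu_lin i f cf.
  split; last by rewrite muE.
  by apply/(integrable_abs_charge (m := mu i)).
- have [z zf] := @weak_limit_barycenter _ _ _ _ FF _ _ hw hX tight _ _ _ mu_stable cb
    (andP c1b).2 mu_integrable kant_lin.
  exists z => f cf; have fM := M_linear f cf; split.
    by apply/(integrable_abs_charge mM).
  by rewrite (cintegralE mM fM) zf.
- move=> b b0 bmu bm U /nbhs_seminorm[q [sq cq qU]].
  have e0 : (0 : R) < 1 / 2 by lra.
  (* The functional norming [b i - b0] changes with [i], hence the uniformity over functionals; the
     bound 1/2 lands inside the unit ball of [q]. *)
  apply: filterS (kant_lin q _ sq cq e0) => i hi; apply: qU => /=.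
  have [f fb fq] := hahn_banach_seminorm (b i - b0) sq.
  have cf := seminorm_bounded_continuous sq cq fq.
  rewrite -fb linearB /=.
  have [_ ->] := bmu i f cf; have [_ ->] := bm f cf.
  have [fi _] := mu_lin i f cf.
  rewrite (muE _ _ fi) (cintegralE mM (M_linear f cf)).
  by have := hi f fq; rewrite ler_norml => /andP[_]; lra.
Qed.
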